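(* Let $X := \left( \bigoplus_{n \in \mathbb{N}} \ell_2^n \right)_Y$, where $Y$ is $c_0$ or $\ell_1$. Then $X$ has the SHAI property.
   Context: All Banach spaces are over $\mathbb{C}$, and $\mathbb{N} = \lbrace 1, 2, \ldots \rbrace$. For a Banach space $X$, $\mathcal{B}(X)$ denotes the algebra of bounded linear operators on $X$. $\ell_2^n$ denotes $\mathbb{C}^n$ with the $\ell_2$-norm. The space $\left( \bigoplus_{n \in \mathbb{N}} \ell_2^n \right)_{\ell_1}$ consists of all sequences $(x_n)_{n \in \mathbb{N}}$ with $x_n \in \ell_2^n$ for each $n$ and $\sum_{n} \Vert x_n \Vert < \infty$, with norm $\Vert (x_n) \Vert = \sum_n \Vert x_n \Vert$. The space $\left( \bigoplus_{n \in \mathbb{N}} \ell_2^n \right)_{c_0}$ consists of all sequences $(x_n)_{n \in \mathbb{N}}$ with $x_n \in \ell_2^n$ for each $n$ and $\lim_{n \to \infty} \Vert x_n \Vert = 0$, with norm $\Vert (x_n) \Vert = \sup_n \Vert x_n \Vert$. A Banach space $X$ has the SHAI property (Surjective Homomorphisms Are Injective) if for every non-zero Banach space $Z$, every surjective algebra homomorphism $\psi: \mathcal{B}(X) \rightarrow \mathcal{B}(Z)$ (a linear multiplicative map; continuity is not assumed) is injective. *)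

(* Defs.v *)
From HB Require Import structures.
From mathcomp Require Import all_boot all_order all_algebra.
From mathcomp Require Import boolp classical_sets functions reals topology.
From mathcomp Require Import normedtype sequences.
From mathcomp Require Import complex ring.

Set Implicit Arguments.
Unset Strict Implicit.
Unset Printing Implicit Defensive.

Import Order.TTheory GRing.Theory Num.Theory.
Import numFieldNormedType.Exports.

Local Open Scope classical_set_scope.
Local Open Scope ring_scope.
Local Open Scope complex_scope.

(** The norm of a normed module over [R[i]] takes its values in [R[i]];
    [rnorm] is the same norm, seen as an element of [R]. *)
Definition rnorm (R : realType) (V : normedZmodType R[i]) (x : V) : R :=
  complex.Re `|x|.

Section rnorm_theory.
Variable R : realType.

Lemma rnormE (V : normedZmodType R[i]) (x : V) : (rnorm x)%:C = `|x|.
Proof.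
rewrite /rnorm; have := normr_ge0 x; case: `|x| => a b.
by rewrite lecE /= => /andP[/eqP-> _].
Qed.

Lemma rnorm_eq (V : normedZmodType R[i]) (x : V) (r : R) :
  `|x| = r%:C -> rnorm x = r.
Proof. by rewrite /rnorm => ->. Qed.

Section normedZmod.
Variable V : normedZmodType R[i].
Implicit Types x y z : V.

Lemma rnorm_ge0 x : 0 <= rnorm x.
Proof. by rewrite -lecR rnormE normr_ge0. Qed.

Lemma rnorm0 : rnorm (0 : V) = 0.
Proof. by rewrite /rnorm normr0. Qed.

Lemma rnorm0_eq0 x : rnorm x = 0 -> x = 0.
Proof. by move=> x0; apply: normr0_eq0; rewrite -rnormE x0. Qed.

Lemma rnormD x y : rnorm (x + y) <= rnorm x + rnorm y.
Proof. by rewrite -lecR rmorphD /= !rnormE ler_normD. Qed.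

Lemma rnormN x : rnorm (- x) = rnorm x.
Proof. by rewrite /rnorm normrN. Qed.

Lemma rdistC x y : rnorm (x - y) = rnorm (y - x).
Proof. by rewrite /rnorm distrC. Qed.

Lemma rdistD z x y : rnorm (x - y) <= rnorm (x - z) + rnorm (z - y).
Proof. by rewrite -[x - y](subrKA z) rnormD. Qed.
End normedZmod.

Lemma rnormZ (V : normedModType R[i]) (c : R[i]) (x : V) :
  rnorm (c *: x) = rnorm c * rnorm x.
Proof. by apply: rnorm_eq; rewrite normrZ rmorphM /= !rnormE. Qed.

Lemma rnormM (c d : R[i]) : rnorm (c * d) = rnorm c * rnorm d.
Proof. by apply: rnorm_eq; rewrite normrM rmorphM /= !rnormE. Qed.

Lemma rnorm_Re (c : R[i]) : `|complex.Re c| <= rnorm c.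
Proof. by rewrite -lecR rnormE normc_ge_Re. Qed.

Lemma rnorm_Im (c : R[i]) : `|complex.Im c| <= rnorm c.
Proof.
rewrite -lecR rnormE normc_def lecR -sqrtr_sqr ler_wsqrtr//.
by rewrite lerDr sqr_ge0.
Qed.

Lemma rnorm_le_ReIm (c : R[i]) :
  rnorm c <= `|complex.Re c| + `|complex.Im c|.
Proof.
rewrite -lecR rnormE normc_def lecR.
rewrite -[leRHS]ger0_norm ?addr_ge0// -sqrtr_sqr ler_wsqrtr//.
rewrite sqrrD !real_normK ?num_real//.
by rewrite lerD2r lerDl mulrn_wge0// mulr_ge0.
Qed.

Section cauchy.
Variables (V : normedModType R[i]) (F : set_system V).
Hypothesis FF : ProperFilter F.

Lemma cauchy_rnorm (e : R) : cauchy F -> 0 < e ->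
  exists2 A, F A & forall x y, A x -> A y -> rnorm (x - y) < e.
Proof.
move=> /(@cauchyP _ V) Fc e0.
have e20 : 0 < (e / 2)%:C :> R[i] by rewrite ltcR divr_gt0.
have [z Fz] := Fc _ e20; exists (ball z (e / 2)%:C) => // x y.
rewrite -!ball_normE /= -!rnormE !ltcR => zx zy.
rewrite (le_lt_trans (rdistD z x y))// (splitr e) ltrD//.
by rewrite rdistC.
Qed.

Lemma rnorm_cvg (l : V) :
  (forall e : R, 0 < e -> \forall x \near F, rnorm (l - x) <= e) -> F --> l.
Proof.
move=> Fl; apply/fcvgrPdist_lt => /= e e0.
have e0' : 0 < complex.Re e by move: e0; rewrite ltcE /= => /andP[].
have eE : e = (complex.Re e)%:C.
  by move: e0; rewrite ltcE /= => /andP[/eqP]; case: e {e0'} => a b /= ->.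
have := Fl (complex.Re e / 2); rewrite divr_gt0// => /(_ isT).
apply: filterS => x; rewrite -rnormE eE ltcR => /le_lt_trans; apply.
by rewrite ltr_pdivrMr// ltr_pMr// ltr1n.
Qed.

Lemma cauchy_cvg_real (p : V -> R) :
  (forall x y, `|p x - p y| <= rnorm (x - y)) -> cauchy F ->
  exists l : R, forall e : R, 0 < e -> \forall x \near F, `|l - p x| <= e.
Proof.
move=> plip Fc.
have : cvg (p @ F).
  apply: R_complete; apply: cauchy_exP => e e0.
  have [A FA Ae] := cauchy_rnorm Fc e0.
  have [x Ax] := filter_ex FA.
  exists (p x); rewrite /fmap /= nbhs_simpl/=; apply: filterS FA => y Ay.
  by rewrite -ball_normE /= (le_lt_trans (plip _ _)) ?Ae.
move=> pc; exists (lim (p @ F)) => e e0.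
by have /cvgrPdist_le/(_ _ e0) := pc.
Qed.

Lemma cauchy_cvg_proj (W : completeNormedModType R[i]) (p : V -> W) :
  (forall x y, rnorm (p x - p y) <= rnorm (x - y)) -> cauchy F ->
  exists l : W, forall e : R, 0 < e -> \forall x \near F, rnorm (l - p x) <= e.
Proof.
move=> plip Fc.
have : cvg (p @ F).
  apply: cauchy_cvg; apply: cauchy_exP => e e0.
  have e0' : 0 < complex.Re e by move: e0; rewrite ltcE /= => /andP[].
  have eE : e = (complex.Re e)%:C.
    by move: e0; rewrite ltcE /= => /andP[/eqP]; case: e {e0'} => a b /= ->.
  have [A FA Ae] := cauchy_rnorm Fc e0'.
  have [x Ax] := filter_ex FA.
  exists (p x); rewrite /fmap /= nbhs_simpl/=; apply: filterS FA => y Ay.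
  by rewrite -ball_normE /= -rnormE eE ltcR (le_lt_trans (plip _ _)) ?Ae.
move=> pc; exists (lim (p @ F)) => e e0.
have e0' : 0 < e%:C by rewrite ltcR.
by have /cvgrPdist_le/(_ _ e0') := pc; apply: filterS => x; rewrite -rnormE lecR.
Qed.

End cauchy.
End rnorm_theory.

(** [l2 R n] is C^n with the Euclidean norm; it is an alias of ['rV[R[i]]_n],
    whose canonical norm in the library is the sup norm. *)
Definition l2 (R : realType) (n : nat) : Type := 'rV[R[i]]_n.

Section l2.
Variables (R : realType) (n : nat).
Local Notation V := (l2 R n).

HB.instance Definition _ := GRing.Lmodule.copy V 'rV[R[i]]_n.

Definition l2norm (x : V) : R :=
  Num.sqrt (\sum_(i < n) rnorm (x ord0 i) ^+ 2).

Let sqsum_ge0 (a : 'I_n -> R) : 0 <= \sum_i a i ^+ 2.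
Proof. by apply: sumr_ge0 => i _; rewrite sqr_ge0. Qed.

Lemma l2_cauchy_schwarz (a b : 'I_n -> R) :
  \sum_i a i * b i <=
  Num.sqrt (\sum_i a i ^+ 2) * Num.sqrt (\sum_i b i ^+ 2).
Proof.
set A := \sum_i a i ^+ 2; set B := \sum_i b i ^+ 2.
have [A0|A0] := eqVneq A 0.
  have a0 i : a i = 0.
    apply/eqP; rewrite -sqrf_eq0; move/eqP: A0.
    by rewrite psumr_eq0 => [/allP/(_ i)|j _]; rewrite ?mem_index_enum ?sqr_ge0//; apply.
  by rewrite A0 sqrtr0 mul0r big1// => i _; rewrite a0 mul0r.
have [B0|B0] := eqVneq B 0.
  have b0 i : b i = 0.
    apply/eqP; rewrite -sqrf_eq0; move/eqP: B0.
    by rewrite psumr_eq0 => [/allP/(_ i)|j _]; rewrite ?mem_index_enum ?sqr_ge0//; apply.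
  by rewrite B0 sqrtr0 mulr0 big1// => i _; rewrite b0 mulr0.
have sA : 0 < Num.sqrt A by rewrite sqrtr_gt0 lt_neqAle eq_sym A0 sqsum_ge0.
have sB : 0 < Num.sqrt B by rewrite sqrtr_gt0 lt_neqAle eq_sym B0 sqsum_ge0.
have SA : Num.sqrt A ^+ 2 = A by rewrite sqr_sqrtr// sqsum_ge0.
have SB : Num.sqrt B ^+ 2 = B by rewrite sqr_sqrtr// sqsum_ge0.
set s := Num.sqrt A in sA SA *; set t := Num.sqrt B in sB SB *.
have key i : 2 * (s * t) * (a i * b i) <= t ^+ 2 * a i ^+ 2 + s ^+ 2 * b i ^+ 2.
  rewrite -subr_ge0; have -> : t ^+ 2 * a i ^+ 2 + s ^+ 2 * b i ^+ 2 -
    2 * (s * t) * (a i * b i) = (t * a i - s * b i) ^+ 2.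
    by ring.
  exact: sqr_ge0.
have : 2 * (s * t) * (\sum_i a i * b i) <= 2 * (s * t) * (s * t).
  rewrite mulr_sumr (le_trans (ler_sum _ (fun i _ => key i)))//.
  rewrite big_split /= -!mulr_sumr -/A -/B -SA -SB.
  by rewrite le_eqVlt; apply/orP; left; apply/eqP; ring.
by rewrite ler_pM2l// !mulr_gt0.
Qed.

Lemma ler_l2normD (x y : V) : l2norm (x + y) <= l2norm x + l2norm y.
Proof.
rewrite /l2norm; set A := \sum_(i < n) rnorm (x _ _) ^+ 2.
set B := \sum_(i < n) rnorm (y _ _) ^+ 2.
have A0 : 0 <= A by apply: sqsum_ge0.
have B0 : 0 <= B by apply: sqsum_ge0.
rewrite -[leRHS]ger0_norm ?addr_ge0 ?sqrtr_ge0// -sqrtr_sqr ler_wsqrtr//.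
rewrite sqrrD !sqr_sqrtr//.
apply: (@le_trans _ _
  (\sum_(i < n) (rnorm (x ord0 i) + rnorm (y ord0 i)) ^+ 2)).
  apply: ler_sum => i _; rewrite ler_sqr ?nnegrE ?rnorm_ge0 ?addr_ge0 ?rnorm_ge0//.
  by rewrite mxE rnormD.
under eq_bigr do rewrite sqrrD.
rewrite !big_split /= -/A -/B lerD2r lerD2l.
by rewrite -mulr2n ler_wMn2r // l2_cauchy_schwarz.
Qed.

Lemma l2normZ (c : R[i]) (x : V) : l2norm (c *: x) = rnorm c * l2norm x.
Proof.
rewrite /l2norm; under eq_bigr do rewrite mxE rnormM exprMn.
by rewrite -mulr_sumr sqrtrM ?sqr_ge0// sqrtr_sqr ger0_norm// rnorm_ge0.
Qed.

Lemma l2norm_eq0 (x : V) : l2norm x = 0 -> x = 0.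
Proof.
move=> /eqP; rewrite sqrtr_eq0 => x0; apply/rowP => i; rewrite mxE.
have /eqP : \sum_(i < n) rnorm (x ord0 i) ^+ 2 = 0.
  by apply/eqP; rewrite eq_le x0 sqsum_ge0.
rewrite psumr_eq0 => [/allP/(_ i)|j _]; last by rewrite sqr_ge0.
by rewrite mem_index_enum => /(_ isT) /=; rewrite sqrf_eq0 => /eqP/rnorm0_eq0.
Qed.

Let norm (x : V) : R[i] := (l2norm x)%:C.

Let ler_normD (x y : V) : norm (x + y) <= norm x + norm y.
Proof. by rewrite -rmorphD lecR ler_l2normD. Qed.

Let normrZ (c : R[i]) (x : V) : norm (c *: x) = `|c| * norm x.
Proof. by rewrite /norm l2normZ rmorphM /= rnormE. Qed.

Let normr0_eq0 (x : V) : norm x = 0 -> x = 0.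
Proof. by move=> [] /l2norm_eq0. Qed.

HB.instance Definition _ :=
  Lmodule_isNormed.Build R[i] V ler_normD normrZ normr0_eq0.

Lemma l2_rnormE (x : V) :
  rnorm x = Num.sqrt (\sum_(i < n) rnorm (x ord0 i) ^+ 2).
Proof. exact: rnorm_eq. Qed.

Lemma l2_coord_le (x : V) i : rnorm (x ord0 i) <= rnorm x.
Proof.
rewrite l2_rnormE -[leLHS]ger0_norm ?rnorm_ge0// -sqrtr_sqr ler_wsqrtr//.
by rewrite (bigD1 i)//= lerDl sumr_ge0// => j _; rewrite sqr_ge0.
Qed.

Lemma l2_le_sum (x : V) : rnorm x <= \sum_(i < n) rnorm (x ord0 i).
Proof.
have S0 : 0 <= \sum_(i < n) rnorm (x ord0 i).
  by apply: sumr_ge0 => i _; exact: rnorm_ge0.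
rewrite l2_rnormE -[leRHS]ger0_norm// -sqrtr_sqr ler_wsqrtr//.
rewrite expr2 mulr_suml; apply: ler_sum => i _.
rewrite expr2 ler_wpM2l ?rnorm_ge0// (bigD1 i)//= lerDl.
by apply: sumr_ge0 => j _; exact: rnorm_ge0.
Qed.

Let l2_complete (F : set_system V) : ProperFilter F -> cauchy F -> cvg F.
Proof.
move=> FF Fc.
have cRe i : exists l : R, forall e : R, 0 < e ->
    \forall x \near F, `|l - complex.Re ((x : V) ord0 i)| <= e.
  apply: cauchy_cvg_real Fc => x y; rewrite -raddfB /=.
  by rewrite (le_trans (rnorm_Re _))// (le_trans _ (l2_coord_le _ i))// !mxE.
have cIm i : exists l : R, forall e : R, 0 < e ->
    \forall x \near F, `|l - complex.Im ((x : V) ord0 i)| <= e.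
  apply: cauchy_cvg_real Fc => x y; rewrite -raddfB /=.
  by rewrite (le_trans (rnorm_Im _))// (le_trans _ (l2_coord_le _ i))// !mxE.
have [a aP] := choice cRe; have [b bP] := choice cIm.
pose l : V := \row_i (a i +i* b i).
apply/cvg_ex; exists l; apply: rnorm_cvg => e e0.
have d0 : 0 < e / (n.+1)%:R / 2 by rewrite !divr_gt0.
have : \forall x \near F, forall i : 'I_n,
    rnorm ((l - x) ord0 i) <= e / (n.+1)%:R.
  apply: filter_forall => i.
  have := aP i _ d0; have := bP i _ d0; apply: filterS2 => x xb xa.
  rewrite (le_trans (rnorm_le_ReIm _))// (splitr (e / _)) lerD// !mxE raddfB//=.
apply: filterS => x xe.
rewrite (le_trans (l2_le_sum _))//.
rewrite (le_trans (ler_sum _ (fun i _ => xe i)))// sumr_const card_ord.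
rewrite -(mulr_natr _ n) mulrAC ler_pdivrMr// ler_pM2l// ler_nat.
exact: leqnSn.
Qed.

HB.instance Definition _ := Uniform_isComplete.Build V l2_complete.

End l2.

Definition seq_prod (R : realType) (V : nat -> completeNormedModType R[i]) :
  Type := forall n, V n.

Section seq_prod.
Variables (R : realType) (V : nat -> completeNormedModType R[i]).
Local Notation P := (seq_prod V).

HB.instance Definition _ := gen_eqMixin P.
HB.instance Definition _ := gen_choiceMixin P.

Let zero : P := fun n => 0.
Let opp (x : P) : P := fun n => - x n.
Let add (x y : P) : P := fun n => x n + y n.
Let scale (c : R[i]) (x : P) : P := fun n => c *: x n.

Let addA : associative add.
Proof. by move=> x y z; apply: functional_extensionality_dep => n; rewrite /add addrA. Qed.
Let addC : commutative add.
Proof. by move=> x y; apply: functional_extensionality_dep => n; rewrite /add addrC. Qed.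
Let add0 : left_id zero add.
Proof. by move=> x; apply: functional_extensionality_dep => n; rewrite /add add0r. Qed.
Let addN : left_inverse zero opp add.
Proof. by move=> x; apply: functional_extensionality_dep => n; rewrite /add addNr. Qed.

HB.instance Definition _ := GRing.isZmodule.Build P addA addC add0 addN.

Let scaleA c d x : scale c (scale d x) = scale (c * d) x.
Proof. by apply: functional_extensionality_dep => n; rewrite /scale scalerA. Qed.
Let scale1 : left_id 1 scale.
Proof. by move=> x; apply: functional_extensionality_dep => n; rewrite /scale scale1r. Qed.
Let scaleDr : right_distributive scale +%R.
Proof. by move=> c x y; apply: functional_extensionality_dep => n; rewrite /scale scalerDr. Qed.
Let scaleDl x : {morph scale^~ x : c d / c + d}.
Proof. by move=> c d; apply: functional_extensionality_dep => n; rewrite /scale scalerDl. Qed.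

HB.instance Definition _ :=
  GRing.Zmodule_isLmodule.Build R[i] P scaleA scale1 scaleDr scaleDl.

End seq_prod.

(** [l1_sum V] and [c0_sum V] are subtypes of [seq_prod V]; their norms are
    computed in [R] and injected into [R[i]] (see [l1_rnormE], [c0_rnormE]). *)
Section l1_sum.
Variables (R : realType) (V : nat -> completeNormedModType R[i]).

Definition l1_summable : {pred seq_prod V} :=
  fun x => `[< cvgn (series (fun n => rnorm (x n))) >].

Lemma l1_summableP (x : seq_prod V) :
  reflect (cvgn (series (fun n => rnorm (x n)))) (x \in l1_summable).
Proof. exact: asboolP. Qed.

Let summable_bound (x : seq_prod V) (M : R) :
  (forall N, series (fun n => rnorm (x n)) N <= M) -> x \in l1_summable.
Proof.
move=> xM; apply/l1_summableP/nondecreasing_is_cvgn.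
  by apply: nondecreasing_series => n _ _; exact: rnorm_ge0.
by exists M => _ [N _ <-].
Qed.

Let le_lim (x : seq_prod V) N : x \in l1_summable ->
  series (fun n => rnorm (x n)) N <= limn (series (fun n => rnorm (x n))).
Proof.
move=> /l1_summableP xs; apply: (nondecreasing_cvgn_le _ xs).
by apply: nondecreasing_series => n _ _; exact: rnorm_ge0.
Qed.

Let lim_le (x : seq_prod V) (M : R) :
  (forall N, series (fun n => rnorm (x n)) N <= M) ->
  limn (series (fun n => rnorm (x n))) <= M.
Proof.
move=> xM; apply: limr_le; last by apply: nearW.
exact/l1_summableP/(summable_bound xM).
Qed.

Let series_scale (c : R[i]) (x : seq_prod V) :
  series (fun n => rnorm ((c *: x) n)) =
  series (rnorm c *: (fun n => rnorm (x n))).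
Proof.
apply/funext => N; rewrite /series /=; apply: eq_bigr => n _.
exact: rnormZ.
Qed.

Let series_add (x y : seq_prod V) N :
  series (fun n => rnorm ((x + y) n)) N <=
  series (fun n => rnorm (x n)) N + series (fun n => rnorm (y n)) N.
Proof. by rewrite /series /= -big_split ler_sum// => n _; exact: rnormD. Qed.

Lemma l1_submod_closed : submod_closed l1_summable.
Proof.
split.
  apply: (@summable_bound _ 0) => N; rewrite /series /= big1// => n _.
  exact: rnorm0.
move=> c x y xs ys.
have cxs : c *: x \in l1_summable.
  apply/l1_summableP; rewrite series_scale; apply: is_cvg_seriesZ.
  exact/l1_summableP.
apply: (@summable_bound _ (limn (series (fun n => rnorm ((c *: x) n))) +
                          limn (series (fun n => rnorm (y n))))) => N.
by rewrite (le_trans (series_add _ _ _))// lerD// le_lim.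
Qed.

HB.instance Definition _ :=
  GRing.isSubmodClosed.Build R[i] (seq_prod V) l1_summable l1_submod_closed.

Record l1_sum : Type := L1Sum {
  l1_val : seq_prod V ;
  l1_valP : l1_val \in l1_summable }.

Definition l1_coord (x : l1_sum) : forall n, V n := l1_val x.
Coercion l1_coord : l1_sum >-> Funclass.

HB.instance Definition _ := [isSub of l1_sum for l1_val].
HB.instance Definition _ := [Choice of l1_sum by <:].
HB.instance Definition _ := [SubChoice_isSubLmodule of l1_sum by <:].

Definition l1_norm (x : l1_sum) : R := limn (series (fun n => rnorm (x n))).

Let norm (x : l1_sum) : R[i] := (l1_norm x)%:C.

Let ler_normD (x y : l1_sum) : norm (x + y) <= norm x + norm y.
Proof.
rewrite -rmorphD lecR; apply: lim_le => N.
rewrite (le_trans (series_add (l1_val x) (l1_val y) N))//.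
by rewrite lerD// le_lim// l1_valP.
Qed.

Let normrZ (c : R[i]) (x : l1_sum) : norm (c *: x) = `|c| * norm x.
Proof.
rewrite /norm -rnormE -rmorphM; congr (_%:C).
rewrite /l1_norm -[RHS]lim_seriesZ; last exact/l1_summableP/l1_valP.
by rewrite -series_scale.
Qed.

Let coord_le (x : l1_sum) n : rnorm (x n) <= l1_norm x.
Proof.
apply: le_trans (le_lim n.+1 (l1_valP x)).
rewrite /series /= big_nat_recr//= lerDr.
by apply: sumr_ge0 => i _; exact: rnorm_ge0.
Qed.

Let normr0_eq0 (x : l1_sum) : norm x = 0 -> x = 0.
Proof.
move=> [] x0; apply/val_inj/functional_extensionality_dep => n /=.
apply: rnorm0_eq0; apply/eqP; rewrite eq_le rnorm_ge0 andbT -x0.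
exact: coord_le.
Qed.

HB.instance Definition _ :=
  Lmodule_isNormed.Build R[i] l1_sum ler_normD normrZ normr0_eq0.

Lemma l1_rnormE (x : l1_sum) :
  rnorm x = limn (series (fun n => rnorm (x n))).
Proof. exact: rnorm_eq. Qed.

Let l1_complete (F : set_system l1_sum) :
  ProperFilter F -> cauchy F -> cvg F.
Proof.
move=> FF Fc.
have cvgV n : exists l : V n, forall e : R, 0 < e ->
    \forall x \near F, rnorm (l - (x : l1_sum) n) <= e.
  by apply: cauchy_cvg_proj Fc => x y; rewrite [leRHS]l1_rnormE (coord_le (x - y)).
pose l : seq_prod V := fun n => projT1 (cid (cvgV n)).
have lP n := projT2 (cid (cvgV n)).
have close (e : R) : 0 < e -> \forall x \near F,
    forall N, series (fun n => rnorm ((l - l1_val x) n)) N <= e.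
  move=> e0; have e20 : 0 < e / 2 by rewrite divr_gt0.
  have [A FA Ae] := cauchy_rnorm FF Fc e20.
  apply: filterS (FA) => x Ax N.
  have d0 : 0 < e / 2 / N.+1%:R by rewrite !divr_gt0.
  have : \forall z \near F, forall n : 'I_N,
      rnorm (l n - (z : l1_sum) n) <= e / 2 / N.+1%:R.
    by apply: filter_forall => n; exact: lP.
  move=> near_z.
  have [z [Az zl]] := filter_ex (filterI FA near_z).
  rewrite /series /= big_mkord.
  apply: (@le_trans _ _
    (\sum_(n < N) (rnorm (l n - z n) + rnorm ((z - x) n)))).
    by apply: ler_sum => n _; exact: rdistD.
  rewrite big_split /= (splitr e) lerD//.
    rewrite (le_trans (ler_sum _ (fun n _ => zl n)))// sumr_const card_ord.
    by rewrite -(mulr_natr _ N) mulrAC ler_pdivrMr// ler_pM2l// ler_nat.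
  rewrite ltW// (le_lt_trans _ (Ae _ _ Az Ax))// l1_rnormE.
  by have := le_lim N (l1_valP (z - x)); rewrite /series /= big_mkord.
have [x xl] := filter_ex (close _ ltr01).
have ls : l \in l1_summable.
  rewrite -[l](subrK (l1_val x)) rpredD ?l1_valP//.
  exact: summable_bound xl.
apply/cvg_ex; exists (L1Sum ls); apply: rnorm_cvg => e e0.
have := close _ e0; apply: filterS => z zl.
by rewrite l1_rnormE; exact: lim_le.
Qed.

HB.instance Definition _ := Uniform_isComplete.Build l1_sum l1_complete.

End l1_sum.

Section c0_sum.
Variables (R : realType) (V : nat -> completeNormedModType R[i]).

Definition c0_vanishing : {pred seq_prod V} :=
  fun x => `[< rnorm (x n) @[n --> \oo] --> (0 : R) >].

Lemma c0_vanishingP (x : seq_prod V) :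
  reflect (rnorm (x n) @[n --> \oo] --> (0 : R)) (x \in c0_vanishing).
Proof. exact: asboolP. Qed.

Let vanishingP (x : seq_prod V) : x \in c0_vanishing <->
  forall e : R, 0 < e -> \forall n \near \oo, rnorm (x n) <= e.
Proof.
split=> [/c0_vanishingP/cvgrPdist_le x0 e e0|x0].
  have := x0 e e0; apply: filterS => n.
  by rewrite sub0r normrN ger0_norm// rnorm_ge0.
apply/c0_vanishingP/cvgrPdist_le => e e0; have := x0 e e0.
by apply: filterS => n; rewrite sub0r normrN ger0_norm// rnorm_ge0.
Qed.

Lemma c0_submod_closed : submod_closed c0_vanishing.
Proof.
split.
  by apply/vanishingP => e e0; apply: nearW => n; rewrite rnorm0 ltW.
move=> c x y /vanishingP xs /vanishingP ys; apply/vanishingP => e e0.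
have c0 : 0 < rnorm c + 1 by rewrite ltr_wpDl// rnorm_ge0.
have e20 : 0 < e / 2 by rewrite divr_gt0.
have := xs _ (divr_gt0 e20 c0); have := ys _ e20; apply: filterS2 => n yn xn.
rewrite (le_trans (rnormD (c *: x n) (y n)))// (splitr e) lerD//.
rewrite rnormZ (@le_trans _ _ ((rnorm c + 1) * rnorm (x n)))//.
  by rewrite ler_wpM2r ?rnorm_ge0// lerDl.
by rewrite mulrC -ler_pdivlMr.
Qed.

HB.instance Definition _ :=
  GRing.isSubmodClosed.Build R[i] (seq_prod V) c0_vanishing c0_submod_closed.

Record c0_sum : Type := C0Sum {
  c0_val : seq_prod V ;
  c0_valP : c0_val \in c0_vanishing }.

Definition c0_coord (x : c0_sum) : forall n, V n := c0_val x.
Coercion c0_coord : c0_sum >-> Funclass.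

HB.instance Definition _ := [isSub of c0_sum for c0_val].
HB.instance Definition _ := [Choice of c0_sum by <:].
HB.instance Definition _ := [SubChoice_isSubLmodule of c0_sum by <:].

Definition c0_norm (x : c0_sum) : R := sup (range (fun n => rnorm (x n))).

Let has_ub (x : c0_sum) : has_ubound (range (fun n => rnorm (x n))).
Proof.
have /c0_vanishingP x0 := c0_valP x.
have [M [_ Mb]] : bounded_fun (fun n => rnorm (x n)).
  by apply: cvg_seq_bounded; apply/cvg_ex; exists (0 : R); exact: x0.
exists (M + 1) => _ [n _ <-].
by rewrite (le_trans (ler_norm _))// (Mb _ _ n)// ltrDl.
Qed.

Let coord_le (x : c0_sum) n : rnorm (x n) <= c0_norm x.
Proof. by apply: ub_le_sup; [exact: has_ub|exists n]. Qed.

Let norm_le (x : c0_sum) (M : R) :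
  (forall n, rnorm (x n) <= M) -> c0_norm x <= M.
Proof.
move=> xM; apply: ge_sup; first by exists (rnorm (x 0%N)), 0%N.
by move=> _ [n _ <-].
Qed.

Let norm (x : c0_sum) : R[i] := (c0_norm x)%:C.

Let ler_normD (x y : c0_sum) : norm (x + y) <= norm x + norm y.
Proof.
rewrite -rmorphD lecR; apply: norm_le => n.
by rewrite (le_trans (rnormD (x n) (y n)))// lerD// coord_le.
Qed.

Let normrZ (c : R[i]) (x : c0_sum) : norm (c *: x) = `|c| * norm x.
Proof.
have le d (y : c0_sum) : c0_norm (d *: y) <= rnorm d * c0_norm y.
  apply: norm_le => n.
  by rewrite (rnormZ d (y n)) ler_wpM2l ?rnorm_ge0// coord_le.
rewrite /norm -rnormE -rmorphM; congr (_%:C); apply/eqP.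
rewrite eq_le le /=.
have [->|c0] := eqVneq c 0.
  rewrite rnorm0 mul0r (le_trans _ (coord_le _ 0%N))//; exact: rnorm_ge0.
have c0' : 0 < rnorm c.
  by rewrite lt_neqAle rnorm_ge0 andbT eq_sym; apply: contra c0 => /eqP/rnorm0_eq0->.
rewrite -ler_pdivlMl//.
have -> : (rnorm c)^-1 = rnorm c^-1.
  apply: (mulfI (lt0r_neq0 c0')).
  by rewrite divff ?lt0r_neq0// -rnormM divff// /rnorm normr1.
by rewrite -[in leLHS](scalerK c0 x) le.
Qed.

Let normr0_eq0 (x : c0_sum) : norm x = 0 -> x = 0.
Proof.
move=> [] x0; apply/val_inj/functional_extensionality_dep => n /=.
apply: rnorm0_eq0; apply/eqP; rewrite eq_le rnorm_ge0 andbT -x0.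
exact: coord_le.
Qed.

HB.instance Definition _ :=
  Lmodule_isNormed.Build R[i] c0_sum ler_normD normrZ normr0_eq0.

Lemma c0_rnormE (x : c0_sum) :
  rnorm x = sup (range (fun n => rnorm (x n))).
Proof. exact: rnorm_eq. Qed.

Let c0_complete (F : set_system c0_sum) :
  ProperFilter F -> cauchy F -> cvg F.
Proof.
move=> FF Fc.
have cvgV n : exists l : V n, forall e : R, 0 < e ->
    \forall x \near F, rnorm (l - (x : c0_sum) n) <= e.
  by apply: cauchy_cvg_proj Fc => x y; rewrite [leRHS]c0_rnormE (coord_le (x - y)).
pose l : seq_prod V := fun n => projT1 (cid (cvgV n)).
have lP n := projT2 (cid (cvgV n)).
have close (e : R) : 0 < e -> \forall x \near F,
    forall n, rnorm ((l - c0_val x) n) <= e.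
  move=> e0; have e20 : 0 < e / 2 by rewrite divr_gt0.
  have [A FA Ae] := cauchy_rnorm FF Fc e20.
  apply: filterS (FA) => x Ax n.
  have [z [Az zl]] := filter_ex (filterI FA (lP n _ e20)).
  apply: (@le_trans _ _ (rnorm (l n - z n) + rnorm ((z - x) n))).
    exact: rdistD.
  rewrite (splitr e) lerD//.
  by rewrite ltW// (le_lt_trans _ (Ae _ _ Az Ax))// c0_rnormE coord_le.
have ls : l \in c0_vanishing.
  apply/vanishingP => e e0; have e20 : 0 < e / 2 by rewrite divr_gt0.
  have [x xl] := filter_ex (close _ e20).
  have /vanishingP/(_ _ e20) := c0_valP x; apply: filterS => n xn.
  rewrite -[l n](subrK (x n)) (le_trans (rnormD _ _))// (splitr e) lerD//.
  exact: xl.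
apply/cvg_ex; exists (C0Sum ls); apply: rnorm_cvg => e e0.
have := close _ e0; apply: filterS => z zl.
by rewrite c0_rnormE; exact: norm_le.
Qed.

HB.instance Definition _ := Uniform_isComplete.Build c0_sum c0_complete.

End c0_sum.

(** The algebra B(X) of bounded operators on X. It is given a module and a
    ring structure, the product being the composition; it is not an [algType]
    because the library requires [1 != 0] there, which fails for [X = 0]. *)
Section bounded_operators.
Variables (R : realType) (X : normedModType R[i]).

Definition bounded_linear : {pred X -> X} := fun f =>
  `[< linear f /\ exists M : R, forall x, rnorm (f x) <= M * rnorm x >].

Lemma bounded_linear_submod_closed : submod_closed bounded_linear.
Proof.
split.
  apply/asboolP; split=> [c x y|]; first by rewrite scaler0 addr0.
  by exists 0 => x; rewrite rnorm0 mul0r.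
move=> c f g /asboolP[fl [M fM]] /asboolP[gl [N gN]]; apply/asboolP; split.
  move=> d x y; rewrite !fctE /= fl gl !scalerDr !scalerA mulrC.
  by rewrite -!addrA; congr (_ + _); rewrite addrCA.
exists (rnorm c * M + N) => x; rewrite (le_trans (rnormD _ _))//.
by rewrite mulrDl lerD// rnormZ -mulrA ler_wpM2l ?rnorm_ge0.
Qed.

HB.instance Definition _ := GRing.isSubmodClosed.Build R[i] (X -> X)
  bounded_linear bounded_linear_submod_closed.

Record bounded_op : Type := BoundedOp {
  bop_fun :> X -> X ;
  bop_funP : bop_fun \in bounded_linear }.

HB.instance Definition _ := [isSub of bounded_op for bop_fun].
HB.instance Definition _ := [Choice of bounded_op by <:].
HB.instance Definition _ := [SubChoice_isSubLmodule of bounded_op by <:].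

Lemma bop_linear (S : bounded_op) : linear S.
Proof. by have /asboolP[] := bop_funP S. Qed.

HB.instance Definition _ (S : bounded_op) :=
  GRing.isLinear.Build R[i] X X *:%R S (bop_linear S).

Lemma bop_bounded (S : bounded_op) :
  exists M : R, forall x, rnorm (S x) <= M * rnorm x.
Proof. by have /asboolP[] := bop_funP S. Qed.

Let id_bounded : (id : X -> X) \in bounded_linear.
Proof. by apply/asboolP; split=> //; exists 1 => x; rewrite mul1r. Qed.

Let comp_bounded (S T : bounded_op) : (S \o T : X -> X) \in bounded_linear.
Proof.
apply/asboolP; split=> [c x y /=|]; first by rewrite !linearP.
have [M SM] := bop_bounded S; have [N TN] := bop_bounded T.
exists (`|M| * N) => x /=; rewrite (le_trans (SM _))//.
rewrite (@le_trans _ _ (`|M| * rnorm (T x)))//.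
  by rewrite ler_wpM2r ?rnorm_ge0// ler_norm.
by rewrite -mulrA ler_wpM2l.
Qed.

Definition bop_id : bounded_op := BoundedOp id_bounded.
Definition bop_comp (S T : bounded_op) : bounded_op :=
  BoundedOp (comp_bounded S T).

Let compA : associative bop_comp.
Proof. by move=> S T U; apply/val_inj. Qed.
Let comp1l : left_id bop_id bop_comp.
Proof. by move=> S; apply/val_inj. Qed.
Let comp1r : right_id bop_id bop_comp.
Proof. by move=> S; apply/val_inj. Qed.
Let compDl : left_distributive bop_comp +%R.
Proof. by move=> S T U; apply/val_inj. Qed.
Let compDr : right_distributive bop_comp +%R.
Proof.
by move=> S T U; apply/val_inj/funext => x /=; rewrite [LHS]linearD.
Qed.

HB.instance Definition _ := GRing.Zmodule_isPzRing.Build bounded_op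
  compA comp1l comp1r compDl compDr.

Lemma bop_mulE (S T : bounded_op) x : (S * T) x = S (T x).
Proof. by []. Qed.

Lemma bop_addE (S T : bounded_op) x : (S + T) x = S x + T x.
Proof. by []. Qed.

Lemma bop_scaleE (c : R[i]) (S : bounded_op) x : (c *: S) x = c *: S x.
Proof. by []. Qed.

Lemma bop_continuous (S : bounded_op) : continuous S.
Proof.
apply: bounded_linear_continuous; apply/linear_boundedP.
have [M SM] := bop_bounded S.
near=> r => x; rewrite -!rnormE.
apply: (@le_trans _ _ (M%:C * (rnorm x)%:C)).
  by rewrite -rmorphM lecR; exact: SM.
rewrite ler_wpM2r ?lecR ?rnorm_ge0//.
by near: r; apply: nbhs_pinfty_ge; rewrite complex_real.
Unshelve. all: by end_near. Qed.

End bounded_operators.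

(** [psi] is not assumed continuous, nor unital. *)
Definition SHAI (R : realType) (X : completeNormedModType R[i]) : Prop :=
  forall Z : completeNormedModType R[i], (exists z : Z, z != 0) ->
  forall psi : {linear bounded_op X -> bounded_op Z},
    {morph psi : S T / S * T >-> S * T} ->
    (forall T, exists S, psi S = T) ->
    injective psi.

(* Main.v *)
Require Import Defs.
From HB Require Import structures.
From mathcomp Require Import all_boot all_order all_algebra.
From mathcomp Require Import boolp classical_sets functions reals topology.
From mathcomp Require Import interval_inference normedtype sequences.
From mathcomp Require Import complex ring lra.

(** Suppose that [psi : B(X) -> B(Z)] is onto, [Z] is non-zero, and [psi] is
    not injective. The contradiction comes from counting: [B(X)] has at most
    the cardinality of the continuum because [X] is separable, while [B(Z)]
    must be strictly larger.

    The kernel of [psi] is a non-zero ideal, so it contains every operator of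
    finite rank built from the coordinates of [X]
    ([finite_rank_in_every_ideal]). Branches [t : nat -> bool] of the binary
    tree index operators [T t] on [X] that are independent modulo finite rank:
    for every finite set [F] of branches and every [theta : F -> {0, 1}] some
    contraction [B] satisfies [B (T t) = theta t] up to finite rank for all
    [t] in [F]. On an l1-sum, [T t] moves the blocks of [x] along the branch
    [t] and [B] adds up the blocks on the selected branches; on a c0-sum,
    level [n] carries one copy of the block for each set of nodes, [T t]
    writes [x] into the copies whose set contains the node of [t], and [B]
    reads the copy of the set of selected nodes ([SHAI_l1], [SHAI_c0]). The
    blocks enter through being finite-dimensional, and through the fact that
    each embeds contractively into all later ones and can be recovered there.

    Fix [z != 0] in [Z] and a bounded functional [f] with [f z = 1], and let
    [w t = psi (T t) z]. Then [f (psi B (w t)) = theta t] for [t] in [F]. The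
    functionals [f o psi B], for [B] a contraction, are uniformly bounded
    although [psi] is not known to be continuous. Indeed the rank-one
    idempotent [E = z (x) f] equals [psi P] for some [P], and no lift of [E]
    is a strict contraction, because [1 - D] is invertible for a strict
    contraction [D] while [1 - E] is not. Applied to the lifts
    [P S P / f (psi S z)] this bounds [f (psi S z)] by [|P|^2 |S|]
    ([coefficient_bound]), and uniform boundedness on [Z] does the rest
    ([coefficients_bounded]).

    Therefore, for an arbitrary [theta] on all the branches, an ultrafilter
    limit over [F] is a bounded functional [h] with [h (w t) = theta t] for
    every [t] ([exists_prescribed]). The operators [z (x) h] exhibit
    [2 ^ continuum] elements of [B(Z)], and Cantor's diagonal argument
    concludes ([no_representation]). *)

Set Implicit Arguments.
Unset Strict Implicit.
Unset Printing Implicit Defensive.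

Import Order.TTheory GRing.Theory Num.Theory.
Import numFieldNormedType.Exports.

Local Open Scope classical_set_scope.
Local Open Scope ring_scope.
Local Open Scope complex_scope.

(** * Complex Banach spaces as real Banach spaces *)

(** An alias carrying the real module structure and a real-valued norm, so that
    the Banach contraction principle and the Banach-Steinhaus theorem, which
    concern modules over a [realType], apply to complex spaces. *)
Definition realify (R : realType) (V : normedModType R[i]) : Type := V.

Section realify.
Variables (R : realType) (V : normedModType R[i]).
Local Notation rV := (realify V).

HB.instance Definition _ := GRing.Zmodule.copy rV V.

Let scale (r : R) (x : rV) : rV := r%:C *: (x : V).

Let scaleA c d x : scale c (scale d x) = scale (c * d) x.
Proof. by rewrite /scale scalerA rmorphM. Qed.
Let scale1 : left_id 1 scale.
Proof. by move=> x; rewrite /scale scale1r. Qed.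
Let scaleDr : right_distributive scale +%R.
Proof. by move=> c x y; rewrite /scale scalerDr. Qed.
Let scaleDl x : {morph scale^~ x : c d / c + d}.
Proof. by move=> c d; rewrite /scale rmorphD scalerDl. Qed.

HB.instance Definition _ :=
  GRing.Zmodule_isLmodule.Build R rV scaleA scale1 scaleDr scaleDl.

Lemma realify_scaleE (r : R) (x : V) : r *: (x : rV) = r%:C *: x.
Proof. by []. Qed.

Let norm (x : rV) : R := rnorm (x : V).

Let ler_normD (x y : rV) : norm (x + y) <= norm x + norm y.
Proof. exact: rnormD. Qed.

Let normrZ (c : R) (x : rV) : norm (c *: x) = `|c| * norm x.
Proof.
rewrite /norm realify_scaleE rnormZ (rnorm_eq (r := `|c|))//.
by rewrite normc_def /= expr0n addr0 sqrtr_sqr.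
Qed.

Let normr0_eq0 (x : rV) : norm x = 0 -> x = 0.
Proof. exact: rnorm0_eq0. Qed.

HB.instance Definition _ :=
  Lmodule_isNormed.Build R rV ler_normD normrZ normr0_eq0.

Lemma realify_normE (x : V) : `|x : rV| = rnorm x.
Proof. by []. Qed.

End realify.

Section realify_complete.
Variables (R : realType) (V : completeNormedModType R[i]).
Local Notation rV := (realify V).

Let realify_complete (F : set_system rV) : ProperFilter F -> cauchy F -> cvg F.
Proof.
move=> FF /cauchyP Fc.
have Fc' : cauchy (F : set_system V).
  apply: (@cauchy_exP R[i] V) => e e0.
  have e0' : 0 < complex.Re e by move: e0; rewrite ltcE /= => /andP[].
  have eE : e = (complex.Re e)%:C.
    by move: e0; rewrite ltcE /= => /andP[/eqP]; case: e {e0'} => a b /= ->.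
  have [x Fx] := Fc _ e0'; exists x; apply: filterS Fx => y.
  by rewrite -!ball_normE /= eE -rnormE ltcR.
have /cvg_ex[l Fl] := @cauchy_cvg V F FF Fc'.
apply/cvg_ex; exists l; apply/fcvgrPdist_lt => e e0.
have e0' : 0 < e%:C :> R[i] by rewrite ltcR.
have /fcvgrPdist_lt /(_ _ e0') := Fl.
by apply: filterS => x; rewrite -rnormE ltcR.
Qed.

HB.instance Definition _ := Uniform_isComplete.Build rV realify_complete.
End realify_complete.

(** * Sublinear functions and the Hahn-Banach theorem *)

Section hahn_banach.
Variables (R : realType) (V : lmodType R).
Implicit Types (p : V -> R) (x y : V).

Definition sublinear p := (forall x y, p (x + y) <= p x + p y) /\
  (forall (r : R) x, 0 <= r -> p (r *: x) = r * p x).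

Lemma sublinear0 p : sublinear p -> p 0 = 0.
Proof. by case=> _ /(_ 0 0 (lexx _)); rewrite scale0r mul0r. Qed.

Lemma sublinearN p x : sublinear p -> - p (- x) <= p x.
Proof.
move=> sp; have := sp.1 x (- x); rewrite subrr (sublinear0 sp); lra.
Qed.

(** The largest sublinear function [q] below [p] with [q (- a) <= - p a]. *)
Definition tilt p a x :=
  inf [set p (x + r *: a) - r * p a | r in [set r | 0 <= r]].

Section tilt.
Variables (p : V -> R) (a : V).
Hypothesis sp : sublinear p.

Let lb x :
  lbound [set p (x + r *: a) - r * p a | r in [set r | 0 <= r]] (- p (- x)).
Proof.
move=> _ [r r0 <-].
have := sp.1 (x + r *: a) (- x); rewrite addrAC subrr add0r sp.2//; lra.
Qed.

Lemma tilt_le x r : 0 <= r -> tilt p a x <= p (x + r *: a) - r * p a.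
Proof.
move=> r0; apply: ge_inf; first by exists (- p (- x)); exact: lb.
by exists r.
Qed.

Lemma le_tilt x c : (forall r, 0 <= r -> c <= p (x + r *: a) - r * p a) ->
  c <= tilt p a x.
Proof.
move=> H; apply: lb_le_inf.
  by exists (p (x + 0 *: a) - 0 * p a); exists 0 => /=.
by move=> _ [r r0 <-]; exact: H.
Qed.

Lemma tilt_lex x : tilt p a x <= p x.
Proof. by have := @tilt_le x 0 (lexx _); rewrite scale0r addr0 mul0r subr0. Qed.

Lemma tiltN : tilt p a (- a) <= - p a.
Proof.
have := @tilt_le (- a) 1 ler01; rewrite scale1r addNr mul1r.
by rewrite (sublinear0 sp) sub0r.
Qed.

Lemma sublinear_tilt : sublinear (tilt p a).
Proof.
split=> [x y|r x].
  rewrite -lerBlDr; apply: le_tilt => r r0; rewrite lerBlDr -lerBlDl.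
  apply: le_tilt => s s0; rewrite lerBlDl.
  apply: le_trans (@tilt_le _ (r + s) (addr_ge0 r0 s0)) _.
  have := sp.1 (x + r *: a) (y + s *: a).
  by rewrite addrACA -scalerDl; lra.
have scal (t : R) y : 0 < t -> tilt p a (t *: y) <= t * tilt p a y.
  move=> t0; rewrite -ler_pdivrMl//; apply: le_tilt => u u0.
  rewrite ler_pdivrMl//.
  apply: le_trans (@tilt_le _ (t * u) _) _; first by rewrite mulr_ge0// ltW.
  by rewrite -scalerA -scalerDr sp.2 ?(ltW t0)// mulrBr mulrA lexx.
rewrite le_eqVlt => /predU1P[<-|r0].
  rewrite scale0r mul0r; apply/eqP; rewrite eq_le; apply/andP; split.
    by rewrite (le_trans (tilt_lex _))// (sublinear0 sp).
  by apply: le_tilt => u u0; rewrite add0r sp.2// subrr.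
apply/eqP; rewrite eq_le scal//= -ler_pdivlMl//.
have := scal r^-1 (r *: x); rewrite invr_gt0 => /(_ r0).
by rewrite scalerA mulVf ?gt_eqF// scale1r.
Qed.

End tilt.

(** A minimal sublinear function [q] below [p] exists by Zorn's lemma. It is
    equal to each of its own tilts, hence odd, and an odd sublinear function is
    linear. *)
Theorem sublinear_minorant p : sublinear p ->
  exists2 h : V -> R, scalar h & forall x, h x <= p x.
Proof.
move=> sp; pose S := {q : V -> R | sublinear q /\ forall x, q x <= p x}.
pose mk q (sq : sublinear q) (qp : forall x, q x <= p x) : S :=
  exist _ q (conj sq qp).
pose Rel (q q' : S) : bool := `[< forall x, sval q' x <= sval q x >].
have [||||[q [sq qp]] qmax] := @Zorn S Rel.
- by move=> q; apply/asboolP.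
- move=> q r s /asboolP qr /asboolP rs; apply/asboolP => x.
  exact: le_trans (rs x) (qr x).
- move=> [q qP] [r rP] /asboolP/= qr /asboolP/= rq.
  apply: eq_exist; apply/funext => x; apply/eqP.
  by rewrite eq_le rq qr.
- move=> A totA; have [[q0 Aq0]|A0] := pselect (exists q, A q); last first.
    by exists (mk p sp (fun x => lexx _)) => s As; case: A0; exists s.
  pose B x := [set sval q x | q in A].
  have lbB x : lbound (B x) (- p (- x)).
    move=> _ [[q [sq qp]] _ <-] /=.
    have := sublinearN x sq; have := qp (- x); lra.
  have hB x : has_inf (B x).
    by split; [exists (sval q0 x), q0|exists (- p (- x)); exact: lbB].
  have infle x q : A q -> inf (B x) <= sval q x.
    by move=> Aq; apply: ge_inf; [exact: (hB x).2|exists q].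
  have le_infB x c : (forall q, A q -> c <= sval q x) -> c <= inf (B x).
    move=> H; apply: lb_le_inf; first exact: (hB x).1.
    by move=> _ [q Aq <-]; exact: H.
  (* the infimum of a chain is subadditive because any two members of the chain
     lie above the smaller of them *)
  have sB : sublinear (fun x => inf (B x)).
    split=> [x y|r x].
      rewrite -lerBlDr; apply: (le_infB) => q Aq; rewrite lerBlDr -lerBlDl.
      apply: (le_infB) => q' Aq'; rewrite lerBlDl.
      have [/asboolP qq'|/asboolP qq'] := totA q q' Aq Aq'.
        apply: le_trans (infle _ _ Aq') _.
        have := (svalP q').1.1 x y; have := qq' x; lra.
      apply: le_trans (infle _ _ Aq) _.
      have := (svalP q).1.1 x y; have := qq' y; lra.
    rewrite le_eqVlt => /predU1P[<-|r0].
      rewrite scale0r mul0r; apply/eqP; rewrite eq_le; apply/andP; split.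
        by rewrite (le_trans (infle _ _ Aq0))// (sublinear0 (svalP q0).1).
      by apply: (le_infB) => q Aq; rewrite (sublinear0 (svalP q).1).
    apply/eqP; rewrite eq_le; apply/andP; split.
      rewrite -ler_pdivrMl//; apply: (le_infB) => q Aq; rewrite ler_pdivrMl//.
      by rewrite (le_trans (infle _ _ Aq))// (svalP q).1.2// ltW.
    apply: (le_infB) => q Aq; rewrite (svalP q).1.2 ?(ltW r0)// ler_wpM2l ?(ltW r0)//.
    exact: infle.
  have Bp x : inf (B x) <= p x.
    by apply: le_trans (infle _ _ Aq0) _; exact: (svalP q0).2.
  exists (mk _ sB Bp) => s As; apply/asboolP => x /=.
  exact: infle.
(* minimality of [q] against its tilt in the direction [x] *)
have qN x : q (- x) = - q x.
  have sT := sublinear_tilt x sq.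
  have Tp y : tilt q x y <= p y := le_trans (tilt_lex x sq y) (qp y).
  have := qmax (mk _ sT Tp).
  have -> : Rel (exist _ q (conj sq qp)) (mk _ sT Tp).
    by apply/asboolP => y /=; exact: tilt_lex.
  move=> /(_ isT) /(congr1 sval)/= E.
  have := tiltN x sq; rewrite E.
  have := sublinearN x sq; lra.
exists q => //.
have qD x y : q (x + y) = q x + q y.
  apply/eqP; rewrite eq_le sq.1 /=.
  have := sq.1 (x + y) (- y); rewrite addrK qN; lra.
move=> r x y; rewrite qD; congr (_ + _).
have [r0|/ltW r0] := leP 0 r; first exact: sq.2.
have /sq.2 : 0 <= - r by rewrite oppr_ge0.
by move=> /(_ x); rewrite scaleNr qN mulNr => /oppr_inj.
Qed.

End hahn_banach.

(** * Bounded functionals on complex normed spaces *)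

Lemma scalar_morph (K : nzRingType) (V : lmodType K) (u : V -> K) : scalar u ->
  [/\ u 0 = 0, {morph u : x / - x}, {morph u : x y / x + y} &
      forall c x, u (c *: x) = c * u x].
Proof.
move=> ul; pose U : {scalar V} := HB.pack u (GRing.isLinear.Build _ _ _ _ _ ul).
split; [exact: (raddf0 U)|exact: (raddfN U)|exact: (raddfD U)|].
by move=> c x; exact: (linearZ_LR U).
Qed.

Section functionals.
Variables (R : realType) (V : normedModType R[i]).
Implicit Types (u : realify V -> R) (f : V -> R[i]) (x z : V).

Definition rbounded u := exists C : R, forall x, `|u x| <= C * rnorm x.
Definition cbounded f := exists C : R, forall x, rnorm (f x) <= C * rnorm x.

(** The complex-linear functional with real part [u]. *)
Definition complexify u x : R[i] := u x +i* - u ('i *: x).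

Lemma realify_complexE (c : R[i]) x : c *: x =
  complex.Re c *: (x : realify V) + complex.Im c *: (('i *: x : V) : realify V).
Proof.
change (c *: x = (complex.Re c)%:C *: x + (complex.Im c)%:C *: ('i *: x)).
rewrite scalerA -scalerDl; congr (_ *: _).
by case: c => a b /=; simpc.
Qed.

Lemma scalar_complexify u : scalar u -> scalar (complexify u).
Proof.
move=> ul.
have [_ _ uD uZ] := scalar_morph ul.
move=> c x y; rewrite /complexify.
have uC (d : R[i]) v : u (d *: v : V) =
    complex.Re d * u v + complex.Im d * u ('i *: v).
  by rewrite realify_complexE uD !uZ.
have uI : u ('i *: (c *: x + y) : V) =
    complex.Re ('i * c) * u x + complex.Im ('i * c) * u ('i *: x) +
    u ('i *: y : V).
  by rewrite (scalerDr 'i (c *: x) y) (uD ('i *: (c *: x)) ('i *: y)) scalerA uC.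
have uR : u (c *: x + y : V) =
    complex.Re c * u x + complex.Im c * u ('i *: x) + u y.
  by rewrite (uD (c *: x : V) y) uC.
rewrite uI uR; move: (u x) (u y) (u ('i *: x)) (u ('i *: y)) => ? ? ? ?.
by case: c {uI uR} => a b; apply/eqP; rewrite eq_complex /=; apply/andP;
  split; apply/eqP; ring.
Qed.

Lemma rnorm_i : rnorm ('i : R[i]) = 1.
Proof. by apply: rnorm_eq; rewrite normc_def /= expr0n expr1n add0r sqrtr1. Qed.

Lemma cbounded_complexify u : rbounded u -> cbounded (complexify u).
Proof.
move=> [C uC]; exists (C + C) => x.
rewrite (le_trans (rnorm_le_ReIm _))//= normrN mulrDl lerD//.
by rewrite (le_trans (uC _))// rnormZ rnorm_i mul1r.
Qed.

Lemma exists_rank_one f z : scalar f -> cbounded f ->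
  exists E : bounded_op V, forall x, E x = f x *: z.
Proof.
move=> fl [C fC].
have P : (fun x => f x *: z : V) \in @bounded_linear R V.
  apply/asboolP; split=> [c x y|]; first by rewrite fl scalerDl scalerA.
  exists (C * rnorm z) => x; rewrite rnormZ mulrAC ler_wpM2r// ?rnorm_ge0//.
by exists (BoundedOp P).
Qed.

(** Tilting the norm in the direction [z] forces the linear minorant to attain
    its largest possible value [rnorm z] at [z]; it is then complexified and
    normalised. *)
Lemma exists_dual z : z != 0 ->
  exists2 f : V -> R[i], scalar f & cbounded f /\ f z = 1.
Proof.
move=> z0.
have z0' : rnorm z != 0 by apply: contra z0 => /eqP/rnorm0_eq0->.
pose p (x : realify V) : R := rnorm (x : V).
have sp : sublinear p.
  split=> [x y|r x r0]; first exact: rnormD.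
  rewrite /p realify_scaleE rnormZ; congr (_ * _).
  by apply: rnorm_eq; rewrite ger0_norm// lecR.
have [u ul up] := sublinear_minorant (sublinear_tilt (z : realify V) sp).
have ule (x : realify V) : u x <= rnorm (x : V).
  by apply: le_trans (up x) _; exact: tilt_lex.
have [_ uN _ _] := scalar_morph ul.
have ub : rbounded u.
  exists 1 => x; rewrite mul1r ler_norml ule andbT.
  by rewrite lerNl -uN (le_trans (ule _))// rnormN.
have uz : u z = rnorm z.
  apply/eqP; rewrite eq_le ule/= -lerN2 -uN.
  by apply: le_trans (up _) _; exact: tiltN.
have fl := scalar_complexify ul.
have fz : complexify u z != 0.
  by apply/eqP => /(congr1 (@complex.Re R)) /= /eqP; rewrite uz (negPf z0').
exists (fun x => (complexify u z)^-1 * complexify u x).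
  by move=> c x y; rewrite fl mulrDr mulrCA.
split; last by rewrite mulVf.
have [C fC] := cbounded_complexify ub.
exists (rnorm (complexify u z)^-1 * C) => x.
by rewrite rnormM -mulrA ler_wpM2l ?rnorm_ge0.
Qed.

End functionals.

(** * Consequences of completeness *)

Section banach.
Variables (R : realType) (X : completeNormedModType R[i]).

Lemma uniform_boundedness (I : Type) (u : I -> realify X -> R) :
  (forall i, scalar (u i)) -> (forall i, rbounded (u i)) ->
  (forall x, exists M : R, forall i, `|u i x| <= M) ->
  exists C : R, forall i (x : X), `|u i x| <= C * rnorm x.
Proof.
move=> ul ub up.
have [] := @Banach_Steinhauss R (realify X) R^o [set u i | i in setT] _ _ 1.
- move=> _ [i _ <-]; split; last exact: ul.
  move=> r; have [C uC] := ub i; exists (`|C| * r) => x xr.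
  rewrite (le_trans (uC x))// (le_trans (y := `|C| * rnorm (x : X)))//.
    by rewrite ler_wpM2r ?rnorm_ge0 ?ler_norm.
  by rewrite ler_wpM2l.
- by move=> x; have [M uM] := up x; exists M => _ [i _ <-]; exact: uM.
move=> M uM; exists M => i x.
have [u0 _ _ uZ] := scalar_morph (ul i).
have [->|x0] := eqVneq x 0; first by rewrite u0 normr0 rnorm0 mulr0.
have nx : 0 < rnorm x.
  rewrite lt_neqAle rnorm_ge0 andbT eq_sym.
  by apply: contra x0 => /eqP/rnorm0_eq0->.
have := uM (u i) (ex_intro2 _ _ i Logic.I erefl)
  ((rnorm x)^-1 *: (x : realify X)).
rewrite normrZ realify_normE ger0_norm ?invr_ge0 ?rnorm_ge0// mulVf ?gt_eqF//.
move=> /(_ (lexx _)).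
by rewrite uZ normrM ger0_norm ?invr_ge0 ?rnorm_ge0// ler_pdivrMl// mulrC.
Qed.

(** The right inverse sends [y] to the fixed point of the contraction
    [x |-> y + D x]. *)
Lemma neumann (D : bounded_op X) (q : R) : 0 <= q -> q < 1 ->
  (forall x, rnorm (D x) <= q * rnorm x) ->
  exists W : bounded_op X, (1 - D) * W = 1.
Proof.
move=> q0 q1 Dq.
have fixp y : exists x, x = y + D x.
  pose g (x : realify X) : realify X := (y + D (x : X) : X).
  have gT : set_fun setT setT g by [].
  pose gF : {fun [set: realify X] >-> [set: realify X]} :=
    HB.pack g (isFun.Build _ _ _ _ g gT).
  have gc : is_contraction gF.
    exists (NngNum q0); split => //= -[x1 x2] _ /=.
    rewrite !realify_normE /g /=.
    have -> : y + D x1 - (y + D x2) = D (x1 - x2 : X).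
      by rewrite linearB opprD addrACA subrr add0r.
    exact: Dq.
  have [||x _ xE] := banach_fixed_point gc; first exact: closedT.
    by exists 0.
  by exists x.
have [w wE] := choice fixp.
have inj x : x = D x -> x = 0.
  move=> xD; apply: rnorm0_eq0; apply/eqP; rewrite eq_le rnorm_ge0 andbT.
  have := Dq x; rewrite -xD -subr_le0 -[X in X - _]mul1r -mulrBl.
  by rewrite pmulr_rle0// subr_gt0.
have wl : linear w.
  move=> c x y; apply/eqP; rewrite -subr_eq0; apply/eqP/inj.
  rewrite linearB /= (bop_linear D) [in LHS](wE (c *: x + y)) [in LHS](wE x).
  rewrite [in LHS](wE y) scalerDr [c *: x + _ + (_ + _)]addrACA.
  by rewrite opprD addrACA subrr add0r.
have wb : w \in @bounded_linear R X.
  apply/asboolP; split => //; exists (1 - q)^-1 => x.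
  rewrite -ler_pdivrMl ?invr_gt0 ?subr_gt0// invrK mulrBl mul1r lerBlDr.
  by rewrite {1}wE (le_trans (rnormD _ _))// lerD2l.
exists (BoundedOp wb); apply/val_inj/funext => x.
by rewrite -[LHS]/(w x - D (w x)) [X in X - _]wE addrK.
Qed.

End banach.

(** * Ultrafilter limits of functionals *)

Section ultralimit.
Variables (R : realType) (V : normedModType R[i]) (G : eqType).

(** The limit is taken along an ultrafilter on the finite sequences [F] that
    contains, for each [t], the set of those [F] to which [t] belongs; a value
    shared by all [u F] with [t] in [F] therefore survives in the limit. *)
Lemma ultralimit (u : seq G -> realify V -> R) (C : R) :
  (forall F, scalar (u F)) -> (forall F (x : V), `|u F x| <= C * rnorm x) ->
  exists2 v : realify V -> R,
    scalar v /\ (forall x : V, `|v x| <= C * rnorm x) &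
    forall (x : V) (c : R) (t : G), (forall F, t \in F -> u F x = c) -> v x = c.
Proof.
move=> ul ub.
pose Fl := filter_from setT
  (fun F0 : seq G => [set F : seq G | {subset F0 <= F}]).
have FlP : ProperFilter Fl.
  apply: filter_from_proper; last by move=> F _; exists F => x.
  apply: filter_from_filter; first by exists [::].
  move=> F1 F2 _ _; exists (F1 ++ F2) => //= F FF.
  by split=> x xF; apply: FF; rewrite mem_cat xF ?orbT.
have [U [UU FU]] := ultraFilterLemma FlP.
have UP := @ultra_proper _ _ UU.
have lim_ex x : exists l : R, u F x @[F --> U] --> l.
  have UI : UltraFilter (u F x @[F --> U]).
    split; first exact: fmap_proper_filter.
    move=> H HP HU; apply/seteqP; split=> A; last exact: HU.
    move=> HA; have [//|/= nA] := @in_ultra_setVsetC _ _ (u ^~ x @^-1` A) UU.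
    exfalso; have HnA : H (~` A) by apply: HU.
    by have [y []] := filter_ex (filterI HA HnA).
  have := @segment_compact R (- (C * rnorm (x : V))) (C * rnorm (x : V)).
  rewrite compact_ultra => /(_ _ UI)[|l [_ ?]]; last by exists l.
  apply: (@filterS _ U _ [set F | `|u F x| <= C * rnorm (x : V)]).
    by move=> F /=; rewrite in_itv /= ler_norml.
  by apply: filterE => F; exact: ub.
have [v vE] := choice lim_ex.
exists v; first split.
- move=> r x y; apply/esym.
  have := cvgD (cvgM (cvg_cst r) (vE x)) (vE y).
  have -> : (cst r * (u^~ x) + (u^~ y))%R = (fun F => u F (r *: x + y)).
    by apply/funext => F; rewrite ul.
  move=> /(_ _ _ _) H; apply: (@cvg_unique _ (@Rhausdorff R) _ _ _ _ H).
  exact: vE.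
- move=> x; have cl : closed (fun y : R => `|y| <= C * rnorm x).
    apply: (@closed_comp _ _ (Num.norm : R -> R) [set y | y <= C * rnorm x]).
      by move=> y _; exact: norm_continuous.
    exact: closed_le.
  by apply: (closed_cvg _ cl _ _ (vE x)); apply: filterE => F; exact: ub.
move=> x c t xc; apply: (@cvg_unique _ (@Rhausdorff R) _ _ _ _ (vE x)).
apply: cvg_near_cst; apply: FU; exists [:: t] => // F tF /=; apply: xc.
by apply: tF; rewrite inE.
Qed.
End ultralimit.

(** * Operators of finite rank, and a bound on the number of operators *)

Section small_operators.
Variables (R : realType) (X : normedModType R[i]).
Local Notation B := (bounded_op X).

Definition two_sided_ideal (I : set B) :=
  (forall S T, I S -> I T -> I (S + T)) /\ (forall U S V, I S -> I (U * S * V)).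

Definition in_every_ideal (S : B) := forall I : set B,
  two_sided_ideal I -> (exists2 S0, I S0 & S0 != 0) -> I S.

Variables (K : Type) (c : K -> X -> R[i]).
Hypothesis c_scalar : forall k, scalar (c k).
Hypothesis c_bounded : forall k, cbounded (c k).
Hypothesis c_total : forall x, (forall k, c k x = 0) -> x = 0.

(** If [c k0 (S0 x0) = l] is non-zero, the rank-one operator [y (x) c k] equals
    [l^-1 (y (x) c k0) S0 (x0 (x) c k)], so it lies in any ideal containing
    [S0]. *)
Lemma finite_rank_in_every_ideal (s : seq K) (y : K -> X) (U : B) :
  (forall x, U x = \sum_(k <- s) c k x *: y k) -> in_every_ideal U.
Proof.
move=> UE I [ID IM] [S0 IS0 S00].
have [x0 [k0 l0]] : exists x0 k0, c k0 (S0 x0) != 0.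
  apply/not_existsP => nc; move/eqP: S00; apply.
  apply/val_inj/funext => x /=; apply: c_total => k; apply/eqP.
  by apply: contrapT => /negP cx; apply: (nc x); exists k.
elim: s U UE => [|k s IHs] U UE.
  suff -> : U = 0 * S0 * 0 by apply: IM.
  by apply/val_inj/funext => x /=; rewrite UE big_nil.
have [V VE] := exists_rank_one (y k) (c_scalar k) (c_bounded k).
have [A AE] := exists_rank_one (y k) (c_scalar k0) (c_bounded k0).
have [D DE] := exists_rank_one x0 (c_scalar k) (c_bounded k).
rewrite -(subrK V U); apply: ID.
  by apply: IHs => x; rewrite -[LHS]/(U x - V x) VE UE big_cons addrC addKr.
suff -> : V = ((c k0 (S0 x0))^-1 *: A) * S0 * D by apply: IM.
apply/val_inj/funext => x; rewrite -[RHS]/((c k0 (S0 x0))^-1 *: A (S0 (D x))).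
have [_ _ _ cZ] := scalar_morph (c_scalar k0).
rewrite [LHS]VE DE AE (linearZ_LR S0) cZ.
by rewrite !scalerA mulrCA mulVf// mulr1.
Qed.

End small_operators.

Section coding.
Variables (R : realType) (X : normedModType R[i]).
Variables (K : countType) (c : K -> X -> R[i]) (e : K -> X).
Hypothesis c_scalar : forall k, scalar (c k).
Hypothesis c_total : forall x, (forall k, c k x = 0) -> x = 0.
Hypothesis e_fundamental :
  forall S : bounded_op X, (forall k, S (e k) = 0) -> S = 0.

Let real_cut (a b : R) : (forall q : rat, (ratr q < a) = (ratr q < b)) -> a = b.
Proof.
move=> ab; apply/eqP; rewrite eq_le !leNgt; apply/andP; split; apply/negP.
  move=> /rat_in_itvoo[q]; rewrite in_itv /= => /andP[bq qa].
  by have := ab q; rewrite qa => /esym /(lt_trans bq); rewrite ltxx.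
move=> /rat_in_itvoo[q]; rewrite in_itv /= => /andP[aq qb].
by have := ab q; rewrite qb => /(lt_trans aq); rewrite ltxx.
Qed.

(** An operator is determined by the countable matrix of its entries
    [c l (S (e k))], and each real or imaginary part by its rational cut. *)
Lemma exists_operator_code :
  exists code : bounded_op X -> (nat -> bool), injective code.
Proof.
pose part (b : bool) (d : R[i]) : R := if b then complex.Re d else complex.Im d.
pose code (S : bounded_op X) n :=
  if unpickle n is Some (k, l, q, b) then
    ratr q < part b (c l (S (e k)))
  else false.
exists code => S T ST; apply/eqP; rewrite -subr_eq0; apply/eqP/e_fundamental => k.
apply: c_total => l.
have [_ cN cD _] := scalar_morph (c_scalar l).
rewrite -[(S - T) (e k)]/(S (e k) - T (e k)) cD cN; apply/eqP; rewrite subr_eq0.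
have pE b : part b (c l (S (e k))) = part b (c l (T (e k))).
  apply: real_cut => q.
  by have := congr1 (fun g => g (pickle (k, l, q, b))) ST; rewrite /code pickleK.
by rewrite eq_complex; apply/andP; split; apply/eqP;
  [exact: (pE true)|exact: (pE false)].
Qed.
End coding.

(** * The counting criterion *)

Section SHAI_criterion.
Variables (R : realType) (X : completeNormedModType R[i]).
Variables (G : eqType) (T : G -> bounded_op X) (code : bounded_op X -> G).
Hypothesis code_inj : injective code.
Hypothesis T_independent : forall (F : seq G) (theta : G -> bool),
  exists2 B : bounded_op X, (forall x, rnorm (B x) <= rnorm x) &
    forall t, t \in F -> in_every_ideal (B * T t - (theta t)%:R).

Section representation.
Variables (Z : completeNormedModType R[i]) (z : Z).
Hypothesis z0 : z != 0.
Variable psi : {linear bounded_op X -> bounded_op Z}.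
Hypothesis psiM : {morph psi : S T / S * T >-> S * T}.
Hypothesis psi_onto : forall T, exists S, psi S = T.
Hypothesis psi_kills : forall S, in_every_ideal S -> psi S = 0.

Let psi1 : psi 1 = 1.
Proof.
have [S S1] := psi_onto 1.
by rewrite -[LHS]mulr1 -S1 -psiM mul1r.
Qed.

Let psi_nat n : psi n%:R = n%:R.
Proof. by rewrite raddfMn /= psi1. Qed.

(** A lift [D] of norm below one would give [(1 - D) W = 1], hence
    [E = E (1 - E) (psi W) = 0]. *)
Lemma idempotent_lift_not_small (E : bounded_op Z) (D : bounded_op X) (q : R) :
  E * E = E -> E != 0 -> 0 <= q -> q < 1 ->
  (forall x, rnorm (D x) <= q * rnorm x) -> psi D != E.
Proof.
move=> EE E0 q0 q1 Dq; apply/eqP => DE.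
have [W /(congr1 psi)] := neumann q0 q1 Dq.
rewrite psiM linearB /= psi1 DE => /(congr1 (fun S => E * S)).
rewrite mulrA mulrBr mulr1 EE subrr mul0r => /esym/eqP.
by apply/negP.
Qed.

Section rank_one.
Variables (f : Z -> R[i]).
Hypotheses (fl : scalar f) (fb : cbounded f) (fz : f z = 1).

(** With [E = z (x) f = psi P] and [l = f (psi S z)], one has
    [E (psi S) E = l E], so [l^-1 P S P] is a lift of the idempotent [E]; its
    norm being at least one, [|l|] is at most [|P|^2 |S|]. *)
Lemma coefficient_bound : exists2 M : R, 0 <= M &
  forall (S : bounded_op X) (C : R), 0 <= C ->
   (forall x, rnorm (S x) <= C * rnorm x) -> rnorm (f (psi S z)) <= M * C.
Proof.
have [E EE] := exists_rank_one z fl fb.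
have [_ _ _ fZ] := scalar_morph fl.
have [P PE] := psi_onto E.
have [M0 PM0] := bop_bounded P; pose M := `|M0|.
have PM x : rnorm (P x) <= M * rnorm x.
  by rewrite (le_trans (PM0 x))// ler_wpM2r ?rnorm_ge0// ler_norm.
have M_ge0 : 0 <= M by exact: normr_ge0.
have Eid : E * E = E.
  apply/val_inj/funext => x; rewrite -[LHS]/(E (E x)) [RHS]EE.
  by rewrite !EE fZ fz mulr1.
have E_neq0 : E != 0.
  apply: contra z0 => /eqP E0; have := EE z; rewrite fz scale1r => <-.
  by rewrite E0.
exists (M * M); first exact: mulr_ge0.
move=> S C C0 SC; rewrite leNgt; apply/negP => big.
set l := f (psi S z) in big.
have l0 : 0 < rnorm l by rewrite (le_lt_trans _ big)// !mulr_ge0.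
have lneq0 : l != 0 by apply: contraTneq l0 => ->; rewrite rnorm0 ltxx.
pose D := l^-1 *: (P * S * P).
have DE : psi D = E.
  rewrite /D linearZ /= !psiM PE.
  apply/val_inj/funext => x; rewrite -[LHS]/(l^-1 *: (E (psi S (E x)))).
  rewrite [RHS]EE (EE x) (linearZ_LR (psi S)) EE fZ -/l.
  by rewrite scalerA mulrCA mulVf// mulr1.
suff : psi D != E by rewrite DE eqxx.
apply: (@idempotent_lift_not_small E D (M * M * C / rnorm l) Eid E_neq0).
- by rewrite divr_ge0 ?rnorm_ge0// !mulr_ge0.
- by rewrite ltr_pdivrMr// mul1r.
move=> x; rewrite -[D x]/(l^-1 *: P (S (P x))) rnormZ.
have -> : rnorm l^-1 = (rnorm l)^-1.
  apply: (mulfI (lt0r_neq0 l0)).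
  by rewrite divff ?lt0r_neq0// -rnormM divff// /rnorm normr1.
rewrite [leRHS]mulrAC [leRHS]mulrC ler_wpM2l ?invr_ge0 ?rnorm_ge0//.
rewrite (le_trans (PM _))// -!mulrA ler_wpM2l// (le_trans (SC _))//.
by rewrite mulrCA ler_wpM2l.
Qed.

Definition contraction_op :=
  {B : bounded_op X | forall x, rnorm (B x) <= rnorm x}.

Definition coefficient (B : contraction_op) (w : realify Z) : R :=
  complex.Re (f (psi (sval B) (w : Z))).

Lemma scalar_coefficient B : scalar (coefficient B).
Proof.
move=> r x y; rewrite /coefficient realify_scaleE linearP fl.
by case: (f (psi _ x)) => a b; case: (f (psi _ y)) => a' b' /=;
  rewrite mul0r subr0.
Qed.

(** Every [w] in [Z] has the form [psi W z], so that the coefficients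
    [f (psi B w) = f (psi (B W) z)] are pointwise bounded by
    [coefficient_bound]. *)
Lemma coefficients_bounded :
  exists C : R, forall B (w : Z), `|coefficient B w| <= C * rnorm w.
Proof.
apply: uniform_boundedness => [|B|w]; first exact: scalar_coefficient.
  have [C fC] := fb; have [M BM] := bop_bounded (psi (sval B)).
  exists (`|C| * M) => w; rewrite (le_trans (rnorm_Re _))// (le_trans (fC _))//.
  rewrite (@le_trans _ _ (`|C| * rnorm (psi (sval B) w)))//.
    by rewrite ler_wpM2r ?rnorm_ge0// ler_norm.
  by rewrite -mulrA ler_wpM2l.
have [E EE] := exists_rank_one (w : Z) fl fb.
have [W WE] := psi_onto E.
have [M M0 fM] := coefficient_bound.
have [C WC] := bop_bounded W.
exists (M * `|C|) => -[B Bc]; rewrite (le_trans (rnorm_Re _))//=.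
have -> : (w : Z) = psi W z by rewrite WE EE fz scale1r.
rewrite -[psi B (psi W z)]/((psi B * psi W) z) -psiM fM// => x.
rewrite (le_trans (Bc _))// (le_trans (WC _))// ler_wpM2r ?rnorm_ge0//.
exact: ler_norm.
Qed.

(** For each finite [F] a contraction [b F] realises [theta] on [F]; the
    ultrafilter limit of the functionals [f o psi (b F)] realises it on all
    of [G]. *)
Lemma exists_prescribed (theta : G -> bool) :
  exists H : bounded_op Z, forall t, H (psi (T t) z) = (theta t)%:R *: z.
Proof.
have [C uC] := coefficients_bounded.
have /choice[b bP] : forall F : seq G, exists B : contraction_op,
    forall t, t \in F -> in_every_ideal (sval B * T t - (theta t)%:R).
  by move=> F; have [B Bc BT] := T_independent F theta; exists (exist _ B Bc).
have [v [vl vC] vE] :=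
  ultralimit (fun F => scalar_coefficient (b F)) (fun F => uC (b F)).
have fbE t F : t \in F -> f (psi (sval (b F)) (psi (T t) z)) = (theta t)%:R.
  move=> /bP/psi_kills; rewrite linearB /= psiM psi_nat => /eqP.
  rewrite subr_eq0 => /eqP /(congr1 (fun S : bounded_op Z => f (S z))).
  rewrite bop_mulE => ->.
  by case: (theta t); rewrite /= ?fz//; have [] := scalar_morph fl.
have [H HE] := exists_rank_one z (scalar_complexify vl)
  (cbounded_complexify (ex_intro _ C vC)).
exists H => t; rewrite HE; congr (_ *: _).
have vt : v (psi (T t) z) = (theta t)%:R.
  by apply: (vE _ _ t) => F tF; rewrite /coefficient fbE//; case: (theta t).
(* the complexification of the limit involves its values at ['i *: _] too *)
have vit : v ('i *: psi (T t) z : Z) = 0.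
  apply: (vE _ _ t) => F tF; rewrite /coefficient linearZ /=.
  have [_ _ _ ->] := scalar_morph fl.
  by rewrite fbE//; case: (theta t); rewrite /= !(mulr0, mul0r, subr0).
by rewrite /complexify vt vit oppr0; case: (theta t).
Qed.

End rank_one.

(** Cantor's diagonal argument: the operator with values [theta] is some
    [psi S], and [theta] was chosen to disagree with [psi S] at the index
    [code S]. *)
Lemma no_representation : False.
Proof.
have [f fl [fb fz]] := exists_dual z0.
pose theta t := `[< exists2 S, code S = t & psi S (psi (T t) z) = 0 >].
have [H HE] := exists_prescribed fl fb fz theta.
have [S SH] := psi_onto H.
have := HE (code S); rewrite -SH.
have [th|th] := boolP (theta (code S)).
  have /asboolP[S' /code_inj -> ->] := th.
  by rewrite scale1r => /esym /eqP; exact/negP.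
rewrite scale0r => SC; move/asboolPn: th; apply.
by exists S.
Qed.

End representation.

Theorem SHAI_criterion : SHAI X.
Proof.
move=> Z [z z0] psi psiM psi_onto S1 S2 S12; apply: contrapT => neq.
apply: (@no_representation Z z z0 psi psiM psi_onto) => S Smin.
apply: (Smin [set S | psi S = 0]).
  split=> [U V /= U0 V0|U V W /= V0]; first by rewrite linearD U0 V0 addr0.
  by rewrite !psiM V0 mulr0 mul0r.
exists (S1 - S2) => /=; first by rewrite linearB S12 subrr.
by apply/eqP => /eqP; rewrite subr_eq0 => /eqP.
Qed.

End SHAI_criterion.

(** * Sequence spaces with Euclidean blocks *)

Lemma ler_sum_uniq (R : realType) (I : eqType) (a : I -> R) (s s' : seq I) :
  (forall i, 0 <= a i) -> uniq s -> {subset s <= s'} ->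
  \sum_(i <- s) a i <= \sum_(i <- s') a i.
Proof.
move=> a0; elim: s s' => [|x s IHs] s' /=.
  by move=> _ _; rewrite big_nil sumr_ge0.
move=> /andP[xs us] ss'; have xs' : x \in s' by apply: ss'; rewrite inE eqxx.
rewrite big_cons (big_rem x xs') lerD2l; apply: IHs => // y ys; rewrite rem_mem//.
  by apply: contraNneq xs => <-.
by apply: ss'; rewrite inE ys orbT.
Qed.

Section resize.
Variable R : realType.

(** Padding with zeros or truncation. It is defined between any two blocks, so
    that no cast is needed to move a vector from one block to another. *)
Definition resize m n (v : l2 R m.+1) : l2 R n.+1 :=
  \row_j (if (j < m.+1)%N then v ord0 (inord j) else 0).

Lemma resize_linear m n : linear (@resize m n).
Proof.
move=> c x y; apply/rowP => j; rewrite !mxE.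
by case: ifP => _; rewrite ?mxE// mulr0 addr0.
Qed.

Lemma resize0 m n : @resize m n 0 = 0.
Proof. by apply/rowP => j; rewrite !mxE; case: ifP; rewrite ?mxE. Qed.

Lemma resizeK m n (v : l2 R m.+1) : (m <= n)%N -> resize m (resize n v) = v.
Proof.
move=> mn; apply/rowP => j; rewrite !mxE.
have jn : (j < n.+1)%N by rewrite (leq_trans (ltn_ord j)).
by rewrite jn inordK// ltn_ord inord_val.
Qed.

Lemma resize_id m (v : l2 R m.+1) : resize m v = v.
Proof. by apply/rowP => j; rewrite !mxE ltn_ord inord_val. Qed.

Lemma resize_le m n (v : l2 R m.+1) : rnorm (resize n v) <= rnorm v.
Proof.
rewrite !l2_rnormE ler_wsqrtr//.
pose a j := rnorm (v ord0 (inord j)) ^+ 2.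
have -> : \sum_(i < m.+1) rnorm (v ord0 i) ^+ 2 =
    \sum_(j <- index_iota 0 m.+1) a j.
  by rewrite big_mkord; apply: eq_bigr => j _; rewrite /a inord_val.
have -> : \sum_(i < n.+1) rnorm (resize n v ord0 i) ^+ 2 =
    \sum_(j <- [seq j <- index_iota 0 n.+1 | (j < m.+1)%N]) a j.
  rewrite big_filter big_mkord [RHS]big_mkcond; apply: eq_bigr => j _.
  by rewrite mxE; case: ifP => // _; rewrite rnorm0 expr0n.
apply: ler_sum_uniq => [j||]; first exact: sqr_ge0.
  by rewrite filter_uniq// iota_uniq.
by move=> j; rewrite mem_filter !mem_index_iota => /andP[->].
Qed.

End resize.

Section sequence_space.
Variable R : realType.
Local Notation V := (fun n => l2 R n.+1).
Variables (X : completeNormedModType R[i]) (co : X -> seq_prod V).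
Hypothesis co_linear : linear co.
Hypothesis co_inj : injective co.
Hypothesis co_le : forall x n, rnorm (co x n) <= rnorm x.
Hypothesis co_fin : forall (s : seq_prod V) N,
  (forall n, (N <= n)%N -> s n = 0) ->
  exists x, co x = s.
Hypothesis co_tail : forall x (e : R), 0 < e -> exists N, forall y,
  (forall n, co y n = if (n < N)%N then 0 else co x n) -> rnorm y <= e.

Let coL : {linear X -> seq_prod V} :=
  HB.pack co (GRing.isLinear.Build _ _ _ _ _ co_linear).

Let coD x y n : co (x + y) n = co x n + co y n.
Proof. exact: (congr1 (fun s : seq_prod V => s n) (linearD coL x y)). Qed.
Let coN x n : co (- x) n = - co x n.
Proof. exact: (congr1 (fun s : seq_prod V => s n) (linearN coL x)). Qed.
Let coZ c x n : co (c *: x) n = c *: co x n.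
Proof. exact: (congr1 (fun s : seq_prod V => s n) (linearZ_LR coL c x)). Qed.
Let co0 n : co 0 n = 0.
Proof. exact: (congr1 (fun s : seq_prod V => s n) (linear0 coL)). Qed.

(** A position [k.2] outside the block [k.1] reads its first coordinate, since
    [inord] then returns [ord0]. *)
Definition entry (k : nat * nat) (x : X) : R[i] :=
  (co x k.1 : l2 R k.1.+1) ord0 (inord k.2).

Lemma entry_scalar k : scalar (entry k).
Proof. by move=> c x y; rewrite /entry coD coZ !mxE. Qed.

Lemma entry_bounded k : cbounded (entry k).
Proof.
by exists 1 => x; rewrite mul1r (le_trans _ (co_le x k.1))// l2_coord_le.
Qed.

Lemma entry_total x : (forall k, entry k x = 0) -> x = 0.
Proof.
move=> x0; apply: co_inj; apply: functional_extensionality_dep => n.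
rewrite co0; apply/rowP => j; rewrite mxE.
by have := x0 (n, nat_of_ord j); rewrite /entry /= inord_val.
Qed.

Let exists_unit (k : nat * nat) : exists x, co x =
  fun m => if m == k.1 then resize m (delta_mx ord0 (inord k.2) : l2 R k.1.+1)
           else 0.
Proof.
by apply: (@co_fin _ k.1.+1) => n kn; rewrite gtn_eqF.
Qed.

Lemma exists_units : exists e : nat * nat -> X, forall k m, co (e k) m =
   if m == k.1 then resize m (delta_mx ord0 (inord k.2) : l2 R k.1.+1) else 0.
Proof. by have [e eP] := choice exists_unit; exists e => k m; rewrite eP. Qed.

Definition head_index N : seq (nat * nat) :=
  [seq (n, i) | n <- index_iota 0 N, i <- index_iota 0 n.+1].

Lemma co_head (e : nat * nat -> X) N x m :
  (forall k m, co (e k) m =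
    if m == k.1 then resize m (delta_mx ord0 (inord k.2) : l2 R k.1.+1)
    else 0) ->
  co (\sum_(k <- head_index N) entry k x *: e k) m =
  if (m < N)%N then co x m else 0.
Proof.
move=> eE.
rewrite (big_morph (fun y => co y m) (fun y z => coD y z m) (co0 m)).
under eq_bigr do rewrite coZ eE.
rewrite big_allpairs_dep /=.
have inner n : \sum_(i <- index_iota 0 n.+1) entry (n, i) x *:
     (if m == n then resize m (delta_mx ord0 (inord i) : l2 R n.+1) else 0)
   = if n == m then co x m else 0.
  have [->|nm] := eqVneq n m; last first.
    by rewrite big1// => i _; rewrite scaler0.
  rewrite big_mkord; apply/rowP => j; rewrite summxE (bigD1 j)//= big1 => [|i ij].
    rewrite addr0 resize_id /entry/= !mxE !inord_val !eqxx mulr1.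
    by congr (co x m _ _); apply/val_inj.
  by rewrite resize_id !mxE inord_val eqxx/= eq_sym (negPf ij) mulr0.
under eq_bigr do rewrite inner.
case: ltnP => mN.
  rewrite (bigD1_seq m) ?mem_index_iota ?iota_uniq//= eqxx big1 ?addr0// => n nm.
  by rewrite (negPf nm).
rewrite big1_seq// => n /andP[_]; rewrite mem_index_iota => /andP[_ nN].
by rewrite ltn_eqF// (leq_trans nN).
Qed.

(** The hypothesis says that [B (T t)] is [theta t] except on the first [N]
    blocks, where it vanishes: the difference is an operator of finite rank. *)
Lemma SHAI_sequence_space (T : (nat -> bool) -> bounded_op X) :
  (forall (F : seq (nat -> bool)) (theta : (nat -> bool) -> bool),
    exists2 B : bounded_op X, (forall x, rnorm (B x) <= rnorm x) &
    exists N, forall t, t \in F -> forall x n, co (B (T t x)) n =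
      if (n < N)%N then 0 else (theta t)%:R *: co x n) ->
  SHAI X.
Proof.
move=> T_ind; have [e eE] := exists_units.
have e_fund (S : bounded_op X) : (forall k, S (e k) = 0) -> S = 0.
  move=> Se; apply/val_inj/funext => x; apply: rnorm0_eq0; apply/eqP.
  rewrite eq_le rnorm_ge0 andbT.
  have [M SM] := bop_bounded S.
  apply/ler_addgt0Pr => d d0; rewrite add0r.
  have M0 : 0 < `|M| + 1 by rewrite ltr_wpDl.
  have [N xN] := co_tail x (divr_gt0 d0 M0).
  pose h := \sum_(k <- head_index N) entry k x *: e k.
  have Sh : S h = 0.
    by rewrite /h linear_sum big1// => k _; rewrite linearZ /= Se scaler0.
  change (rnorm (S x) <= d).
  have -> : S x = S (x - h) by rewrite linearB /= Sh subr0.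
  rewrite (le_trans (SM _))// (@le_trans _ _ ((`|M| + 1) * rnorm (x - h)))//.
    by rewrite ler_wpM2r ?rnorm_ge0// (le_trans (ler_norm _))// lerDl.
  rewrite -ler_pdivlMl// mulrC; apply: xN => n.
  by rewrite coD coN co_head//; case: ifP; rewrite ?subrr ?subr0.
have [code code_inj] := exists_operator_code entry_scalar entry_total e_fund.
apply: (SHAI_criterion code_inj (T := T)) => F theta.
have [B Bc [N BT]] := T_ind F theta; exists B => // t tF.
apply: (finite_rank_in_every_ideal entry_scalar entry_bounded entry_total
  (s := head_index N) (y := fun k => - (theta t)%:R *: e k)) => x.
apply: co_inj; apply: functional_extensionality_dep => n.
have -> : \sum_(k <- head_index N) entry k x *: (- (theta t)%:R *: e k) =
    - (theta t)%:R *: (\sum_(k <- head_index N) entry k x *: e k).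
  by rewrite scaler_sumr; apply: eq_bigr => k _; rewrite !scalerA mulrC.
rewrite coZ co_head//.
have -> : (B * T t - (theta t)%:R) x = B (T t x) - (theta t)%:R *: x.
  by rewrite -[LHS]/(B (T t x) - (((theta t)%:R : bounded_op X) x));
    congr (_ - _);
    case: (theta t); rewrite ?scale1r ?scale0r.
rewrite coD coN coZ (BT _ tF); case: ifP => _.
  by rewrite sub0r scaleNr.
by rewrite subrr scaler0.
Qed.

End sequence_space.

(** * Branches of the binary tree and rearrangements of blocks *)

Section branches.
Local Open Scope nat_scope.

Definition branch (t : nat -> bool) n : n.-tuple bool := [tuple t i | i < n].

Lemma branch_separated (F : seq (nat -> bool)) : exists N, forall n, N <= n ->
  {in F &, injective (fun t => branch t n)}.
Proof.
have sep (p : (nat -> bool) * (nat -> bool)) :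
    exists i, p.1 <> p.2 -> p.1 i <> p.2 i.
  have [->|ne] := pselect (p.1 = p.2); first by exists 0.
  have /existsNP[i ti] : ~ (forall i, p.1 i = p.2 i).
    by move=> E; apply: ne; apply/funext.
  by exists i.
have [d dP] := choice sep.
exists (\max_(p <- [seq (t, s) | t <- F, s <- F]) (d p).+1).
move=> n Nn t s tF sF /= ts.
apply: contrapT => ne; apply: (dP (t, s) ne) => /=.
have dn : d (t, s) < n.
  apply: leq_trans Nn.
  apply: (@leq_bigmax_seq _ _ xpredT (fun p => (d p).+1)) => //.
  by apply/allpairsP; exists (t, s).
have := congr1 (fun u : n.-tuple bool => tnth u (Ordinal dn)) ts.
by rewrite !tnth_mktuple.
Qed.

(** The block at which the [j]-th copy of block [n] is stored. It comes after
    block [n], so that this block fits into it. *)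
Definition slot n j := CodeSeq.code [:: n; j].

Definition unslot m : option (nat * nat) :=
  if CodeSeq.decode m is [:: n; j] then Some (n, j) else None.

Lemma slotK n j : unslot (slot n j) = Some (n, j).
Proof. by rewrite /unslot /slot CodeSeq.codeK. Qed.

Lemma unslotK m n j : unslot m = Some (n, j) -> m = slot n j.
Proof.
rewrite /unslot; case E : (CodeSeq.decode m) => [|n' [|j' []]]// [<- <-].
by rewrite /slot -E CodeSeq.decodeK.
Qed.

Lemma ltn_slot n j : n < slot n j.
Proof. by have /andP[] := CodeSeq.ltn_code [:: n; j]. Qed.

Lemma slot_inj n j n' j' : slot n j = slot n' j' -> n = n' /\ j = j'.
Proof. by move=> /(congr1 unslot); rewrite !slotK => -[-> ->]. Qed.

Lemma uniq_flatten_map (I J : eqType) (L : I -> seq J) (s : seq I) :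
  (forall i, uniq (L i)) ->
  (forall i i' j, j \in L i -> j \in L i' -> i = i') ->
  uniq s -> uniq (flatten [seq L i | i <- s]).
Proof.
move=> Lu Ld; elim: s => //= i s IHs /andP[is_ us].
rewrite cat_uniq Lu IHs// andbT; apply/hasPn => j /flatten_mapP[i' i's ji'].
by apply: contra is_ => ji; rewrite (Ld _ _ _ ji ji').
Qed.

End branches.

Section gather.
Variable R : realType.
Local Notation V := (fun n => l2 R n.+1 : completeNormedModType R[i]).
Implicit Types (L : nat -> seq nat) (x : seq_prod V).

Definition gather L x : seq_prod V := fun n => \sum_(k <- L n) resize n (x k).

Lemma gather_linear L : linear (gather L).
Proof.
move=> c x y; apply: functional_extensionality_dep => n.
rewrite -[RHS]/(c *: gather L x n + gather L y n).
rewrite /gather scaler_sumr -big_split /=.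
by apply: eq_bigr => k _; rewrite -resize_linear.
Qed.

Lemma gather_le L x n : rnorm (gather L x n) <= \sum_(k <- L n) rnorm (x k).
Proof.
rewrite /gather; elim: (L n) => [|k s IHs]; first by rewrite !big_nil rnorm0.
by rewrite !big_cons (le_trans (rnormD _ _))// lerD// resize_le.
Qed.

End gather.

(** * The l1-sum *)

Section l1.
Variable R : realType.
Local Notation V := (fun n => l2 R n.+1 : completeNormedModType R[i]).
Local Notation X := (l1_sum V).

Lemma series_rnorm_mono (x : seq_prod V) :
  nondecreasing_seq (series (fun n => rnorm (x n))).
Proof. by apply: nondecreasing_series => n _ _; exact: rnorm_ge0. Qed.

Lemma l1_summable_bounded (x : seq_prod V) (M : R) :
  (forall N, series (fun n => rnorm (x n)) N <= M) -> x \in @l1_summable R V.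
Proof.
move=> xM; apply/l1_summableP/nondecreasing_is_cvgn.
  exact: series_rnorm_mono.
by exists M => _ [N _ <-].
Qed.

Lemma l1_series_le (x : X) N : series (fun n => rnorm (x n)) N <= rnorm x.
Proof.
rewrite l1_rnormE; apply: nondecreasing_cvgn_le; first exact: series_rnorm_mono.
exact/l1_summableP/l1_valP.
Qed.

Lemma l1_rnorm_le (x : X) (M : R) :
  (forall N, series (fun n => rnorm (x n)) N <= M) -> rnorm x <= M.
Proof.
move=> xM; rewrite l1_rnormE; apply: limr_le; last by apply: nearW.
exact/l1_summableP/l1_valP.
Qed.

(** No block is read twice, so the norms of the new blocks add up to at most
    the norm of [x]. *)
Lemma l1_gather (L : nat -> seq nat) : (forall n, uniq (L n)) ->
  (forall n n' k, k \in L n -> k \in L n' -> n = n') ->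
  exists2 B : bounded_op X, (forall x, rnorm (B x) <= rnorm x) &
    forall x n, B x n = gather L (l1_val x) n.
Proof.
move=> Lu Ld.
have bound (x : X) N :
    series (fun n => rnorm (gather L (l1_val x) n)) N <= rnorm x.
  pose s := flatten [seq L n | n <- index_iota 0 N].
  apply: (@le_trans _ _ (\sum_(k <- s) rnorm (x k))).
    rewrite big_flatten big_map /= /series /=; apply: ler_sum => n _.
    exact: gather_le.
  apply: le_trans (l1_series_le x (\max_(k <- s) k).+1).
  rewrite /series /=; apply: ler_sum_uniq => [k||k ks]; first exact: rnorm_ge0.
    by apply: uniq_flatten_map => //; exact: iota_uniq.
  by rewrite mem_index_iota ltnS (@leq_bigmax_seq _ _ xpredT id).
pose f (x : X) : X := L1Sum (l1_summable_bounded (bound x)).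
have fb (x : X) : rnorm (f x) <= rnorm x by apply: l1_rnorm_le => N; exact: bound.
have fP : f \in @bounded_linear R X.
  apply/asboolP; split=> [c x y|]; last first.
    by exists 1 => x; rewrite mul1r fb.
  by apply/val_inj; exact: (gather_linear L c (l1_val x) (l1_val y)).
by exists (BoundedOp fP).
Qed.

(** [T t] moves block [n] to the slot of the node of [t] at level [n]. From the
    level at which the branches in [F] are pairwise distinct, [B] adds up the
    slots on the branches selected by [theta]; these slots are all distinct,
    hence [B] is a contraction. *)
Lemma SHAI_l1 : SHAI X.
Proof.
pose g (t : nat -> bool) n := slot n (pickle (branch t n)).
pose LT t m : seq nat :=
  if unslot m is Some (n, j) then
    if j == pickle (branch t n) then [:: n] else [::]
  else [::].
have LTP t m n : n \in LT t m -> m = g t n.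
  rewrite /LT; case E : (unslot m) => [[n' j]|//].
  by case: eqP => // jE; rewrite inE => /eqP->; rewrite (unslotK E) jE.
have /choice[T TE] (t : nat -> bool) : exists T : bounded_op X,
    forall x n, T x n = gather (LT t) (l1_val x) n.
  have [||T _ TE] := @l1_gather (LT t); last by exists T.
    by move=> m; rewrite /LT; case: unslot => [[? ?]|//]; case: eqP.
  by move=> m m' n /LTP -> /LTP ->.
apply: (@SHAI_sequence_space R X (@l1_coord R V) _ _ _ _ _ T).
- by [].
- by move=> x y xy; apply/val_inj.
- move=> x n; apply: le_trans (l1_series_le x n.+1).
  rewrite /series /= big_nat_recr//= lerDr.
  by apply: sumr_ge0 => i _; exact: rnorm_ge0.
- move=> s N sN.
  have sP : s \in @l1_summable R V.
    apply: (@l1_summable_bounded _ (series (fun n => rnorm (s n)) N)) => M.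
    have [MN|/ltnW NM] := leqP M N; first exact: series_rnorm_mono.
    rewrite /series /= (big_cat_nat (leq0n N) NM)//=.
    rewrite [X in _ + X]big1_seq ?addr0// => n.
    by rewrite mem_index_iota => /andP[_ /andP[Nn _]]; rewrite sN// rnorm0.
  by exists (L1Sum sP).
- move=> x d d0.
  have /l1_summableP/cvgrPdist_le/(_ d d0)[N _ /(_ N (leqnn N))] := l1_valP x.
  rewrite -/(l1_coord x) => xN; exists N => y yE; apply: l1_rnorm_le => M.
  have xd : rnorm x - series (fun n => rnorm (x n)) N <= d.
    by rewrite l1_rnormE (le_trans (ler_norm _)).
  have low n : (n <= N)%N -> series (fun n => rnorm (y n)) n = 0.
    move=> nN; rewrite /series /= big1_seq// => k.
    rewrite mem_index_iota => /andP[_ /andP[_ kn]].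
    by rewrite yE (leq_trans kn nN) rnorm0.
  have [MN|/ltnW NM] := leqP M N; first by rewrite low// ltW.
  apply: le_trans xd; have := l1_series_le x M.
  have := low N (leqnn N).
  rewrite /series /= !(big_cat_nat (leq0n N) NM)//= => ->.
  rewrite add0r lerBrDl; apply: le_trans; rewrite lerD2l.
  apply: ler_sum_nat => n /andP[Nn _].
  by rewrite yE ltnNge Nn.
move=> F theta; pose F' := undup [seq t <- F | theta t].
have [N Nsep] := branch_separated F.
pose LB n : seq nat := if (n < N)%N then [::] else [seq g t n | t <- F'].
have LBP n k : k \in LB n -> exists j, k = slot n j.
  by rewrite /LB; case: ltnP => // _ /mapP[t _ ->]; exists (pickle (branch t n)).
have F'F t : t \in F' -> t \in F.
  by rewrite mem_undup mem_filter => /andP[].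
have g_inj n t s : (N <= n)%N -> t \in F -> s \in F -> g t n = g s n -> t = s.
  by move=> Nn tF sF /slot_inj[_ /(pcan_inj pickleK)]; exact: Nsep.
have [||B Bc BE] := @l1_gather LB.
- move=> n; rewrite /LB; case: ltnP => // Nn.
  rewrite map_inj_in_uniq ?undup_uniq//.
  by move=> t s /F'F tF /F'F sF; exact: g_inj.
- by move=> n n' k /LBP[j ->] /LBP[j' /slot_inj[]].
exists B => //; exists N => t tF x n.
rewrite [LHS]BE /gather /LB; case: ltnP => [_|Nn]; first by rewrite big_nil.
rewrite big_map.
have term s : s \in F' -> resize n (l1_val (T t x) (g s n)) =
    if s == t then x n else 0.
  move=> /F'F sF; rewrite -/(l1_coord (T t x) (g s n)) TE /gather /LT slotK.
  rewrite (inj_eq (pcan_inj pickleK)).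
  have [->|st] := eqVneq s t.
    by rewrite eqxx big_seq1 resizeK// ltnW// ltn_slot.
  rewrite ifF; first by rewrite big_nil resize0.
  by apply: contraNF st => /eqP bst; apply/eqP; exact: (Nsep n).
rewrite (eq_big_seq _ term) -big_mkcond /=.
case th : (theta t); last first.
  rewrite scale0r big1_seq// => s /andP[/eqP->].
  by rewrite mem_undup mem_filter th.
rewrite scale1r big_mkcond (bigD1_seq t)/= ?undup_uniq ?mem_undup ?mem_filter ?th//.
by rewrite eqxx big1 ?addr0// => s /negPf->.
Qed.

End l1.

(** * The c0-sum *)

Section c0.
Variable R : realType.
Local Notation V := (fun n => l2 R n.+1 : completeNormedModType R[i]).
Local Notation X := (c0_sum V).

Lemma c0_vanishing_eventually (x : seq_prod V) : x \in @c0_vanishing R V <->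
  forall e : R, 0 < e -> exists N, forall n, (N <= n)%N -> rnorm (x n) <= e.
Proof.
split=> [/c0_vanishingP/cvgrPdist_le x0 e e0|x0].
  have [N _ xN] := x0 e e0; exists N => n Nn.
  by have := xN n Nn; rewrite /= sub0r normrN ger0_norm// rnorm_ge0.
apply/c0_vanishingP/cvgrPdist_le => e e0; have [N xN] := x0 e e0.
by exists N => // n Nn; rewrite sub0r normrN ger0_norm ?rnorm_ge0// xN.
Qed.

Lemma c0_coord_le (x : X) n : rnorm (x n) <= rnorm x.
Proof.
rewrite c0_rnormE; apply: ub_le_sup; last by exists n.
have /c0_vanishingP x0 := c0_valP x.
have [M [_ Mb]] : bounded_fun (fun n => rnorm (x n)).
  by apply: cvg_seq_bounded; apply/cvg_ex; exists (0 : R); exact: x0.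
exists (M + 1) => _ [k _ <-].
by rewrite (le_trans (ler_norm _))// (Mb _ _ k)// ltrDl.
Qed.

Lemma c0_rnorm_le (x : X) (M : R) : (forall n, rnorm (x n) <= M) -> rnorm x <= M.
Proof.
move=> xM; rewrite c0_rnormE; apply: ge_sup; first by exists (rnorm (x 0%N)), 0%N.
by move=> _ [n _ <-].
Qed.

(** At most one block is read for each block written, which gives the norm
    bound; the blocks that are read go to infinity, so the image vanishes at
    infinity. *)
Lemma c0_gather (L : nat -> seq nat) : (forall n, (size (L n) <= 1)%N) ->
  (forall K, exists M, forall m k, (M <= m)%N -> k \in L m -> (K <= k)%N) ->
  exists2 B : bounded_op X, (forall x, rnorm (B x) <= rnorm x) &
    forall x n, B x n = gather L (c0_val x) n.
Proof.
move=> L1 Linf.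
have bound (x : X) n (e : R) : 0 <= e ->
    (forall k, k \in L n -> rnorm (x k) <= e) ->
    rnorm (gather L (c0_val x) n) <= e.
  move=> e0 xe; apply: le_trans (gather_le L (c0_val x) n) _.
  case: (L n) (L1 n) xe => [|k []]// _ xe; first by rewrite big_nil.
  by rewrite big_seq1 xe// inE.
have van (x : X) : gather L (c0_val x) \in @c0_vanishing R V.
  apply/c0_vanishing_eventually => e e0.
  have /c0_vanishing_eventually/(_ e e0)[K xK] := c0_valP x.
  have [M LM] := Linf K; exists M => n Mn; apply: bound; first exact: ltW.
  by move=> k /(LM _ _ Mn); exact: xK.
pose f (x : X) : X := C0Sum (van x).
have fb (x : X) : rnorm (f x) <= rnorm x.
  apply: c0_rnorm_le => n; apply: bound; first exact: rnorm_ge0.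
  by move=> k _; exact: c0_coord_le.
have fP : f \in @bounded_linear R X.
  apply/asboolP; split=> [c x y|]; last first.
    by exists 1 => x; rewrite mul1r fb.
  by apply/val_inj; exact: (gather_linear L c (c0_val x) (c0_val y)).
by exists (BoundedOp fP).
Qed.

(** Sums over several branches are not contractions here, so the selection is
    stored in the slots instead: level [n] has one slot for each set [A] of
    nodes, [T t] copies block [n] into the slots whose set contains the node of
    [t], and [B] reads the slot of the set of nodes of the selected branches. *)
Lemma SHAI_c0 : SHAI X.
Proof.
pose LT (t : nat -> bool) m : seq nat :=
  if unslot m is Some (n, j) then
    if (pickle_inv j : option {set n.-tuple bool}) is Some A then
      if branch t n \in A then [:: n] else [::]
    else [::]
  else [::].
have LTP t m n : n \in LT t m ->
    exists A : {set n.-tuple bool}, m = slot n (pickle A).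
  rewrite /LT; case E : (unslot m) => [[n' j]|//].
  have := @pickle_invK {set n'.-tuple bool} j; case: pickle_inv => [A /= Aj|//].
  case: ifP => // _; rewrite inE => /eqP->; exists A.
  by rewrite (unslotK E) Aj.
have /choice[T TE] (t : nat -> bool) : exists T : bounded_op X,
    forall x n, T x n = gather (LT t) (c0_val x) n.
  have [||T _ TE] := @c0_gather (LT t); last by exists T.
    move=> m; rewrite /LT; case: unslot => [[? ?]|//]; case: pickle_inv => // A.
    by case: ifP.
  (* each level has finitely many slots, hence [LT t m] avoids the blocks below
     [K] for large [m] *)
  move=> K; pose b n := (\max_(A : {set n.-tuple bool}) slot n (pickle A))%N.
  exists (\max_(n < K) b n).+1 => m n Mm /LTP[A mA].
  rewrite leqNgt; apply/negP => nK; move: Mm; rewrite ltnNge => /negP; apply.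
  rewrite mA (leq_trans _ (@leq_bigmax _ (fun n : 'I_K => b n) (Ordinal nK)))//=.
  exact: (@leq_bigmax _ (fun A : {set n.-tuple bool} => slot n (pickle A))).
apply: (@SHAI_sequence_space R X (@c0_coord R V) _ _ _ _ _ T).
- by [].
- by move=> x y xy; apply/val_inj.
- exact: c0_coord_le.
- move=> s N sN.
  have sP : s \in @c0_vanishing R V.
    apply/c0_vanishing_eventually => e e0; exists N => n Nn.
    by rewrite sN// rnorm0 ltW.
  by exists (C0Sum sP).
- move=> x d d0.
  have /c0_vanishing_eventually/(_ d d0)[N xN] := c0_valP x.
  exists N => y yE; apply: c0_rnorm_le => n; rewrite yE.
  by case: ltnP => [_|Nn]; [rewrite rnorm0 ltW|exact: xN].
move=> F theta; pose F' := [seq t <- F | theta t].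
have [N Nsep] := branch_separated F.
pose A n : {set n.-tuple bool} := [set u in [seq branch t n | t <- F']].
pose LB n : seq nat := if (n < N)%N then [::] else [:: slot n (pickle (A n))].
have [||B Bc BE] := @c0_gather LB.
- by move=> n; rewrite /LB; case: ifP.
- move=> K; exists K => m k Km; rewrite /LB; case: ifP => // _.
  by rewrite inE => /eqP->; rewrite (leq_trans Km)// ltnW// ltn_slot.
exists B => //; exists N => t tF x n.
rewrite [LHS]BE /gather /LB; case: ltnP => [_|Nn]; first by rewrite big_nil.
rewrite big_seq1 -/(c0_coord (T t x) _) TE /gather /LT slotK pickleK_inv.
have -> : branch t n \in A n = theta t.
  rewrite inE; apply/mapP/idP => [[s]|th]; last first.
    by exists t; rewrite ?mem_filter ?th.
  rewrite mem_filter => /andP[ths sF] bts.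
  by rewrite (Nsep n Nn t s tF sF bts).
case: (theta t); last by rewrite big_nil resize0 scale0r.
by rewrite big_seq1 resizeK ?scale1r// ltnW// ltn_slot.
Qed.

End c0.

Theorem theorem1p5 (R : realType) :
  SHAI (c0_sum (fun n => l2 R n.+1)) /\ SHAI (l1_sum (fun n => l2 R n.+1)).
Proof. by split; [exact: SHAI_c0|exact: SHAI_l1]. Qed.
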